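(* Fix a positive integer $N$. Write $r^{\vec\alpha}=r_0^{\alpha_0}\cdots r_{N-1}^{\alpha_{N-1}}$ for $\vec\alpha\in\mathbb N^N$ and $s^{\vec\beta}=s_1^{\beta_1}\cdots s_{N-1}^{\beta_{N-1}}$ for $\vec\beta\in\mathbb N^{N-1}$. Then, as formal power series in $z$, $$\sum_{\substack{n,j\ge 0\\ \vec\alpha\in\mathbb N^N\\ \vec\beta\in\mathbb N^{N-1}}} Q_{n,j,\vec\alpha,\vec\beta}(\mathbf x)\,z^n t^j r^{\vec\alpha}s^{\vec\beta} =\frac{H(r_0z)(1-t)\left(\prod_{m=1}^{N-1}E(-s_mz)H(r_ms_mz)\right)}{\left(1+\sum_{m=1}^{N-1}s_m\right)H(tz)-\left(t+\sum_{m=1}^{N-1}s_m\right)H(z)}.$$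
   Context: $\mathbb N=\{0,1,2,\dots\}$, $[n]=\{1,\dots,n\}$, $\mathbf x=\{x_1,x_2,\dots\}$ is an infinite set of commuting variables. $H(z)=\sum_{i\ge0}h_i(\mathbf x)z^i$ and $E(z)=\sum_{i\ge0}e_i(\mathbf x)z^i$, with $h_i,e_i$ the complete homogeneous and elementary symmetric functions. Colored permutations: an element $\pi\in C_N\wr S_n$ is a word $\pi=\pi_1\cdots\pi_n$ whose letters are $\pi_i=|\pi_i|^{\epsilon_i}$ with $|\pi_i|\in[n]$ and color $\epsilon_i\in\{0,\dots,N-1\}$, such that $|\pi_1|\cdots|\pi_n|$ is a permutation of $[n]$. Letters are totally ordered by $1^{N-1}<2^{N-1}<\dots<n^{N-1}<1^{N-2}<\dots<n^{N-2}<\dots<1^0<\dots<n^0$. Statistics: $\mathrm{EXC}(\pi)=\{i\in[n]:\pi_i>i^0\}$, $\mathrm{exc}(\pi)=|\mathrm{EXC}(\pi)|$; $\mathrm{fix}_k(\pi)=|\{i\in[n]:\pi_i=i^k\}|$ for $0\le k\le N-1$ and $\vec{\mathrm{fix}}(\pi)=(\mathrm{fix}_0(\pi),\dots,\mathrm{fix}_{N-1}(\pi))$; $\mathrm{col}_m(\pi)=|\{i\in[n]:\epsilon_i=m\}|$ for $1\le m\le N-1$ and $\vec{\mathrm{col}}(\pi)=(\mathrm{col}_1(\pi),\dots,\mathrm{col}_{N-1}(\pi))$. The set $\mathrm{DEX}(\pi)\subseteq[n-1]$: enlarge the alphabet by letters $\widetilde{1^0}<\widetilde{2^0}<\dots<\widetilde{n^0}$,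 all smaller than every untilded letter. Let $\widetilde\pi$ be obtained from $\pi$ by replacing $\pi_i$ by $\widetilde{\pi_i}$ for each $i\in\mathrm{EXC}(\pi)$. Then $\mathrm{DEX}(\pi)=\{i\in[n-1]:\widetilde\pi_i>\widetilde\pi_{i+1}\}$. For $T\subseteq[n-1]$, $F_{T,n}(\mathbf x)=\sum x_{i_1}\cdots x_{i_n}$ over all $i_1\ge i_2\ge\dots\ge i_n\ge1$ with $i_j>i_{j+1}$ whenever $j\in T$; $F_{\emptyset,0}=1$. For $n,j\in\mathbb N$, $\vec\alpha\in\mathbb N^N$, $\vec\beta\in\mathbb N^{N-1}$: $Q_{n,j,\vec\alpha,\vec\beta}(\mathbf x)=\sum_\pi F_{\mathrm{DEX}(\pi),n}(\mathbf x)$, the sum over all $\pi\in C_N\wr S_n$ with $\mathrm{exc}(\pi)=j$, $\vec{\mathrm{fix}}(\pi)=\vec\alpha$, $\vec{\mathrm{col}}(\pi)=\vec\beta$. For $n=0$ there is only the empty word, with all statistics zero, so $Q_{0,0,\vec0,\vec0}=1$. *)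

(* Defs.v *)
From HB Require Import structures.
From mathcomp Require Import all_boot all_order all_algebra all_fingroup finmap.
From mathcomp Require Import mathcomp_extra boolp classical_sets functions.
From mathcomp Require Import cardinality fsbigop.
From mathcomp Require Import monalg.
Set Implicit Arguments.
Unset Strict Implicit.
Unset Printing Implicit Defensive.

Import GRing.Theory.
Local Open Scope ring_scope.

Local Notation "1" := (@mone _) : monom_scope.
Local Notation "x * y" := (mmul x y) : monom_scope.
Local Notation "'U_(' i )" := (@ucm _ i) : monom_scope.

(* [{cmonom V}] is the free commutative monoid on [V], i.e. the monomials with
   finitely many variables; [U_(v)%M] is the variable [v] as a monomial. *)
Record mps (V : choiceType) (R : Type) := MPS { mcoef : {cmonom V} -> R }.

(* The operations below are locked, to keep unification from unfolding them. *)
Fact mps_key : unit. Proof. exact: tt. Qed.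

Section MPSZmod.
Context {V : choiceType} {R : zmodType}.
Implicit Types (f g : mps V R) (m : {cmonom V}).

Lemma mpsP f g : (forall m, mcoef f m = mcoef g m) -> f = g.
Proof. by case: f g => [f] [g] /= /funext ->. Qed.

HB.instance Definition _ := gen_eqMixin (mps V R).
HB.instance Definition _ := gen_choiceMixin (mps V R).

Definition mps_zero : mps V R := MPS (fun=> 0).
Definition mps_opp : mps V R -> mps V R :=
  locked_with mps_key (fun f => MPS (fun m => - mcoef f m)).
Definition mps_add : mps V R -> mps V R -> mps V R :=
  locked_with mps_key (fun f g => MPS (fun m => mcoef f m + mcoef g m)).

Fact mps_oppE f m : mcoef (mps_opp f) m = - mcoef f m.
Proof. by rewrite /mps_opp unlock. Qed.
Fact mps_addE f g m : mcoef (mps_add f g) m = mcoef f m + mcoef g m.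
Proof. by rewrite /mps_add unlock. Qed.

Fact mps_addA : associative mps_add.
Proof. by move=> f g h; apply: mpsP => m; rewrite !mps_addE addrA. Qed.
Fact mps_addC : commutative mps_add.
Proof. by move=> f g; apply: mpsP => m; rewrite !mps_addE addrC. Qed.
Fact mps_add0 : left_id mps_zero mps_add.
Proof. by move=> f; apply: mpsP => m; rewrite mps_addE add0r. Qed.
Fact mps_addN : left_inverse mps_zero mps_opp mps_add.
Proof. by move=> f; apply: mpsP => m; rewrite mps_addE mps_oppE addNr. Qed.

HB.instance Definition _ :=
  GRing.isZmodule.Build (mps V R) mps_addA mps_addC mps_add0 mps_addN.

Lemma mcoef0 m : mcoef (0 : mps V R) m = 0. Proof. by []. Qed.
Lemma mcoefD f g m : mcoef (f + g) m = mcoef f m + mcoef g m.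
Proof. exact: mps_addE. Qed.
Lemma mcoefN f m : mcoef (- f) m = - mcoef f m.
Proof. exact: mps_oppE. Qed.
Lemma mcoefB f g m : mcoef (f - g) m = mcoef f m - mcoef g m.
Proof. by rewrite mcoefD mcoefN. Qed.
Lemma mcoef_sum I (r : seq I) (P : pred I) (F : I -> mps V R) m :
  mcoef (\sum_(i <- r | P i) F i) m = \sum_(i <- r | P i) mcoef (F i) m.
Proof.
by apply: (big_morph (fun f => mcoef f m)) => [f g|]; rewrite ?mcoefD ?mcoef0.
Qed.

End MPSZmod.

Section Divisors.
Context {V : choiceType}.
Implicit Types m a b : {cmonom V}.

Lemma finite_divisors m : finite_set [set a | exists b, (a * b)%M = m]%classic.
Proof.
pose dec (f : {ffun finsupp m -> 'I_(mdeg m).+1}) : {cmonom V} :=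
  [cmonom (f i : nat) | i : finsupp m]%M.
apply: (@sub_finite_set _ _ (dec @` [set: _])%classic); last first.
  by apply: finite_image; exact: finite_finset.
move=> a [b abm]; have leam i : (a i <= m i)%N by rewrite -abm cmM leq_addr.
have lem i : (m i <= mdeg m)%N.
  have [im|/fsfun_dflt->//] := boolP (i \in finsupp m).
  by rewrite mdegE (big_fsetD1 i) //= leq_addr.
exists [ffun i => inord (a (val i))] => //; apply/eqP/cmP => i.
rewrite /dec cmE fsfun_ffun.
case: insubP => [j jm <-|im].
  by rewrite /= ffunE inordK ?eqxx // ltnS (leq_trans (leam _)).
by apply/esym/eqP; rewrite -leqn0 (leq_trans (leam i)) // fsfun_dflt.
Qed.

Definition mfactors m : set ({cmonom V} * {cmonom V}) :=
  [set p | (p.1 * p.2)%M = m]%classic.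

Lemma finite_mfactors m : finite_set (mfactors m).
Proof.
pose D := [set a | exists b, (a * b)%M = m]%classic.
apply: (@sub_finite_set _ _ (D `*` D)%classic).
  by move=> [a b] /= abm; split; [exists b|exists a; rewrite mulmC].
by apply: finite_setX; exact: finite_divisors.
Qed.

Definition divisors_of m : {fset {cmonom V}} :=
  fset_set [set a | exists b, (a * b)%M = m]%classic.

Lemma divisors_ofP m a :
  reflect (exists b, (a * b)%M = m) (a \in divisors_of m).
Proof.
rewrite /divisors_of in_fset_set; last exact: finite_divisors.
by apply: (iffP idP); rewrite inE.
Qed.

End Divisors.

Section MPSRing.
Context {V : choiceType} {R : comNzRingType}.
Implicit Types (f g h : mps V R) (m a b : {cmonom V}).

Definition mpsM : {cmonom V} -> mps V R :=
  locked_with mps_key (fun m => MPS (fun m' => (m' == m)%:R)).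
Definition mpsX : V -> mps V R := locked_with mps_key (fun v => mpsM U_(v)%M).

Lemma mcoef_mpsM m m' : mcoef (mpsM m) m' = (m' == m)%:R.
Proof. by rewrite /mpsM unlock. Qed.
Lemma mpsXE v : mpsX v = mpsM U_(v)%M.
Proof. by rewrite /mpsX unlock. Qed.

Definition mps_one : mps V R := mpsM 1%M.
Definition mps_mul : mps V R -> mps V R -> mps V R :=
  locked_with mps_key (fun f g =>
    MPS (fun m => \sum_(p \in mfactors m) mcoef f p.1 * mcoef g p.2)).

Lemma mps_mulEf f g m : mcoef (mps_mul f g) m =
  \sum_(p \in mfactors m) mcoef f p.1 * mcoef g p.2.
Proof. by rewrite /mps_mul unlock. Qed.

Lemma mps_mulE m d f g : d \in divisors_of m ->
  mcoef (mps_mul f g) d = \sum_(a <- divisors_of m) \sum_(b <- divisors_of m)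
     (if (a * b)%M == d then mcoef f a * mcoef g b else 0).
Proof.
move=> /divisors_ofP[e de]; pose D := divisors_of m.
transitivity (\sum_(p <- [seq (a, b) | a <- D, b <- D])
   (if (p.1 * p.2)%M == d then mcoef f p.1 * mcoef g p.2 else 0)); last first.
  by rewrite big_allpairs_dep.
rewrite -big_mkcond /= mps_mulEf.
pose L := [seq p <- [seq (a, b) | a <- D, b <- D] | (p.1 * p.2)%M == d].
rewrite (fsbigE L) /L.
- rewrite big_filter_cond; apply: eq_bigl => p.
  case: eqP => //= pd; exact: mem_set.
- apply: filter_uniq; apply: allpairs_uniq; rewrite ?fset_uniq //.
  by move=> [? ?] [? ?].
- by move=> p /=; rewrite mem_filter => /andP[/eqP].
move=> [a b] /= abd; rewrite mem_filter /= abd eqxx /= => /negP[].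
apply: allpairs_f.
  by apply/divisors_ofP; exists (b * e)%M; rewrite mulmA abd.
by apply/divisors_ofP; exists (a * e)%M; rewrite mulmA (mulmC b) abd.
Qed.

Lemma divisors_of_id m : m \in divisors_of m.
Proof. by apply/divisors_ofP; exists 1%M; rewrite mulm1. Qed.

Fact mps_mulC : commutative mps_mul.
Proof.
move=> f g; apply: mpsP => m; rewrite !(mps_mulE _ _ (divisors_of_id m)).
rewrite exchange_big /=; apply: eq_bigr => a _; apply: eq_bigr => b _.
by rewrite mulmC mulrC.
Qed.

Lemma mps_mul3E f g h m : mcoef (mps_mul (mps_mul f g) h) m =
  \sum_(a <- divisors_of m) \sum_(b <- divisors_of m) \sum_(c <- divisors_of m)
    (if (a * b * c)%M == m then mcoef f a * mcoef g b * mcoef h c else 0).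
Proof.
rewrite (mps_mulE _ _ (divisors_of_id m)); set D := divisors_of m.
transitivity (\sum_(d <- D) \sum_(c <- D) \sum_(a <- D) \sum_(b <- D)
  (if (d * c)%M == m then if (a * b)%M == d then
     mcoef f a * mcoef g b * mcoef h c else 0 else 0)).
  apply: eq_big_seq => d dD; apply: eq_bigr => c _.
  case: ifP => _; last by rewrite big1 // => a _; rewrite big1.
  rewrite (mps_mulE _ _ dD) mulr_suml; apply: eq_bigr => a _.
  rewrite mulr_suml; apply: eq_bigr => b _.
  by case: ifP; rewrite ?mul0r.
under eq_bigr do rewrite exchange_big /=.
rewrite exchange_big /=; apply: eq_bigr => a _.
under eq_bigr do rewrite exchange_big /=.
rewrite exchange_big /=; apply: eq_bigr => b _.
rewrite exchange_big /=; apply: eq_bigr => c _.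
have [abc|abc] := eqVneq (a * b * c)%M m; last first.
  apply: big1_seq => d _; case: eqP => // dc; case: eqP => // abd.
  by rewrite abd dc eqxx in abc.
have abD : (a * b)%M \in D by apply/divisors_ofP; exists c.
rewrite (big_rem _ abD) /= abc !eqxx big1_seq ?addr0 // => d.
rewrite mem_rem_uniq ?fset_uniq // inE => /andP[_ /andP[dab _]].
by rewrite [(a * b)%M == d]eq_sym (negPf dab); case: ifP.
Qed.

Fact mps_mulA : associative mps_mul.
Proof.
move=> f g h; apply: mpsP => m; rewrite [in LHS]mps_mulC !mps_mul3E.
under eq_bigr do rewrite exchange_big /=.
rewrite [LHS]exchange_big /=; apply: eq_bigr => a _; apply: eq_bigr => b _.
apply: eq_bigr => c _; rewrite [in LHS]mulmC mulmA.
by case: ifP => // _; rewrite mulrC mulrA.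
Qed.

Fact mps_mul1 : left_id mps_one mps_mul.
Proof.
move=> f; apply: mpsP => m; rewrite (mps_mulE _ _ (divisors_of_id m)).
have D1 : 1%M \in divisors_of m by apply/divisors_ofP; exists m; rewrite mul1m.
rewrite (big_rem _ D1) /= [X in _ + X]big1_seq ?addr0; last first.
  move=> a; rewrite mem_rem_uniq ?fset_uniq // inE => /andP[_ /andP[/negPf aN1 _]].
  by rewrite big1 // => b _; rewrite mcoef_mpsM aN1 mul0r if_same.
rewrite mcoef_mpsM.
rewrite (big_rem _ (divisors_of_id m)) /= mul1m !eqxx mul1r big1_seq ?addr0 //.
move=> b; rewrite mem_rem_uniq ?fset_uniq // inE => /andP[_ /andP[/negPf bNm _]].
by rewrite mul1m bNm.
Qed.

Fact mps_mulD : left_distributive mps_mul +%R.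
Proof.
move=> f g h; apply: mpsP => m.
rewrite mcoefD !(mps_mulE _ _ (divisors_of_id m)) -big_split /=.
apply: eq_bigr => a _; rewrite -big_split /=; apply: eq_bigr => b _.
by case: ifP; rewrite ?addr0 // mcoefD mulrDl.
Qed.

Fact mps_one_neq0 : mps_one != 0.
Proof.
apply/eqP => /(congr1 (fun f => mcoef f 1%M)) /eqP.
by rewrite mcoef_mpsM mcoef0 eqxx oner_eq0.
Qed.

HB.instance Definition _ := GRing.Zmodule_isComNzRing.Build (mps V R)
  mps_mulA mps_mulC mps_mul1 mps_mulD mps_one_neq0.

Definition mps_scale : R -> mps V R -> mps V R :=
  locked_with mps_key (fun c f => MPS (fun m => c * mcoef f m)).

Fact mps_scaleE (c : R) f m : mcoef (mps_scale c f) m = c * mcoef f m.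
Proof. by rewrite /mps_scale unlock. Qed.
Fact mps_scaleA (c d : R) f : mps_scale c (mps_scale d f) = mps_scale (c * d) f.
Proof. by apply: mpsP => m; rewrite !mps_scaleE mulrA. Qed.
Fact mps_scale1 : left_id 1 mps_scale.
Proof. by move=> f; apply: mpsP => m; rewrite mps_scaleE mul1r. Qed.
Fact mps_scaleDr : right_distributive mps_scale +%R.
Proof. by move=> c f g; apply: mpsP => m; rewrite !(mps_scaleE, mcoefD) mulrDr. Qed.
Fact mps_scaleDl f : {morph mps_scale^~ f : c d / c + d >-> c + d}.
Proof. by move=> c d; apply: mpsP => m; rewrite !(mps_scaleE, mcoefD) mulrDl. Qed.

HB.instance Definition _ := GRing.Zmodule_isLmodule.Build R (mps V R)
  mps_scaleA mps_scale1 mps_scaleDr mps_scaleDl.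

Lemma mcoefZ (c : R) f m : mcoef (c *: f) m = c * mcoef f m.
Proof. exact: mps_scaleE. Qed.
Lemma mcoef1 m : mcoef (1 : mps V R) m = (m == 1%M)%:R.
Proof. exact: mcoef_mpsM. Qed.
Lemma mcoefM f g m : mcoef (f * g) m =
  \sum_(p \in mfactors m) mcoef f p.1 * mcoef g p.2.
Proof. exact: mps_mulEf. Qed.
Lemma mcoefME f g m : mcoef (f * g) m =
  \sum_(a <- divisors_of m) \sum_(b <- divisors_of m)
     (if (a * b)%M == m then mcoef f a * mcoef g b else 0).
Proof. exact/mps_mulE/divisors_of_id. Qed.

Fact mps_scaleAl (c : R) f g : c *: (f * g) = c *: f * g.
Proof.
apply: mpsP => m; rewrite mcoefZ !mcoefME mulr_sumr.
apply: eq_bigr => a _; rewrite mulr_sumr; apply: eq_bigr => b _.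
by case: ifP; rewrite ?mulr0 // mcoefZ mulrA.
Qed.

HB.instance Definition _ :=
  GRing.Lmodule_isLalgebra.Build R (mps V R) mps_scaleAl.

Fact mps_scaleAr (c : R) f g : c *: (f * g) = f * (c *: g).
Proof. by rewrite mulrC mps_scaleAl mulrC. Qed.

HB.instance Definition _ :=
  GRing.Lalgebra_isAlgebra.Build R (mps V R) mps_scaleAr.

Lemma mcoefM1 f g : mcoef (f * g) 1%M = mcoef f 1%M * mcoef g 1%M.
Proof.
rewrite mcoefM (_ : mfactors 1%M = [set (1%M, 1%M)]%classic) ?fsbig_set1 //.
apply/seteqP; split=> [[a b]|_ ->] /=; last by rewrite /mfactors /= mulm1.
by move/(unitm a b) => [-> ->].
Qed.

Lemma mcoefX_lt f n m : mcoef f 1%M = 0 -> (mdeg m < n)%N ->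
  mcoef (f ^+ n) m = 0.
Proof.
move=> f0; elim: n m => // n IHn m mn; rewrite exprS mcoefM.
apply: fsbig1 => -[a b] /= abm; rewrite /mfactors/= in abm.
have [->|a1] := eqVneq a 1%M; first by rewrite f0 mul0r.
rewrite IHn ?mulr0 //; rewrite -mdeg_eq0 -lt0n in a1.
by rewrite -ltnS (leq_trans _ mn) // -abm mdegM ltnS -addn1 addnC leq_add2r.
Qed.

Lemma mpsM1 : mpsM 1%M = 1. Proof. by []. Qed.

Lemma mpsMM m1 m2 : mpsM (m1 * m2)%M = mpsM m1 * mpsM m2.
Proof.
apply: mpsP => m; rewrite mcoefM mcoef_mpsM.
under eq_fsbigr do rewrite !mcoef_mpsM.
have [->|ne] := eqVneq m (m1 * m2)%M.
  rewrite (fsbigE [:: (m1, m2)]) //=.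
  - by rewrite big_cons big_nil !eqxx /= ifT ?mulr1 ?addr0 //; apply: mem_set.
  - by move=> p /=; rewrite inE => /eqP ->.
  move=> [a b] _; rewrite inE xpair_eqE /= negb_and.
  by case/orP => /negPf ->; rewrite ?mul0r ?mulr0.
rewrite fsbig1 // => -[a b] /= abm; rewrite /mfactors/= in abm.
case: eqP => [am|]; last by rewrite mul0r.
by case: eqP => [bm|]; rewrite ?mulr0 //; rewrite -abm am bm eqxx in ne.
Qed.

Lemma mpsMX m n : mpsM (\big[mmul/1%M]_(i < n) m) = mpsM m ^+ n.
Proof.
elim: n => [|n IHn]; first by rewrite big_ord0.
by rewrite big_ord_recl mpsMM IHn exprS.
Qed.

Lemma mpsM_prod I (r : seq I) (P : pred I) (F : I -> {cmonom V}) :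
  mpsM (\big[mmul/1%M]_(i <- r | P i) F i) = \prod_(i <- r | P i) mpsM (F i).
Proof. exact: (big_morph mpsM mpsMM mpsM1). Qed.

End MPSRing.

Section MPSUnitRing.
Context {V : choiceType} {R : comUnitRingType}.
Implicit Types (f g h : mps V R) (m a b : {cmonom V}).

Definition mps_unit : pred (mps V R) :=
  [pred f | mcoef f 1%M \is a GRing.unit].

(* [f = c (1 - g)] with [c] the constant coefficient of [f], whose inverse is
   [c^-1 (1 + g + g^2 + ...)]. *)
Definition mps_inv : mps V R -> mps V R := locked_with mps_key (fun f =>
  if mps_unit f then
    let c := mcoef f 1%M in
    MPS (fun m => c^-1 * mcoef (\sum_(k < (mdeg m).+1) (1 - c^-1 *: f) ^+ k) m)
  else f).

Lemma mps_geo (g u : mps V R) : mcoef g 1%M = 0 ->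
  (forall m, mcoef u m = mcoef (\sum_(k < (mdeg m).+1) g ^+ k) m) ->
  (1 - g) * u = 1.
Proof.
move=> g0 uE; have uE' m n : (mdeg m < n)%N ->
    mcoef u m = mcoef (\sum_(k < n) g ^+ k) m.
  move=> mn; rewrite uE !mcoef_sum.
  rewrite -!(big_mkord xpredT (fun k => mcoef (g ^+ k) m)).
  rewrite [RHS](big_cat_nat (n := (mdeg m).+1)) //=.
  rewrite [X in _ = _ + X]big1_seq ?addr0 // => k /andP[_].
  by rewrite mem_index_iota => /andP[mk _]; exact: mcoefX_lt.
apply: mpsP => m; transitivity
    (mcoef ((1 - g) * \sum_(k < (mdeg m).+1) g ^+ k) m); last first.
  by rewrite -opprB mulNr -subrX1 opprB mcoefB mcoefX_lt // subr0.
rewrite !mcoefM; apply: eq_fsbigr => -[a b]; rewrite inE /mfactors /= => abm.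
by rewrite (@uE' b (mdeg m).+1) // -abm mdegM ltnS leq_addl.
Qed.

Fact mps_mulVf : {in mps_unit, left_inverse 1 mps_inv *%R}.
Proof.
move=> f fU; rewrite /mps_inv unlock (fU : mps_unit f).
set c := mcoef f 1%M; set u := MPS _; have cU : c \is a GRing.unit := fU.
have cu : (1 - (1 - c^-1 *: f)) * (c *: u) = 1.
  apply: mps_geo => [|m]; last by rewrite mcoefZ /= mulVKr.
  by rewrite mcoefB mcoef1 eqxx mcoefZ mulVr // subrr.
by rewrite mulrC -cu subKr -scalerAl -scalerAr scalerA mulVr // scale1r.
Qed.

Fact mps_unitPl f g : g * f = 1 -> mps_unit f.
Proof.
move=> /(congr1 (fun h => mcoef h 1%M)).
rewrite mcoefM1 mcoef1 eqxx => gf1.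
by apply/unitrP; exists (mcoef g 1%M); split=> //; rewrite mulrC.
Qed.

Fact mps_inv_out : {in [predC mps_unit], mps_inv =1 id}.
Proof. by move=> f /negP fU; rewrite /mps_inv unlock; case: ifP => // /fU. Qed.

HB.instance Definition _ := GRing.ComNzRing_hasMulInverse.Build (mps V R)
  mps_mulVf mps_unitPl mps_inv_out.

Lemma mps_unitE f : (f \is a GRing.unit) = (mcoef f 1%M \is a GRing.unit).
Proof. by []. Qed.

End MPSUnitRing.

Section FormalSum.
Context {V : choiceType} {R : zmodType} {K : choiceType}.

(* Infinite sums are taken coefficientwise.  They are meaningful for summable
   families only: a coefficient with infinitely many contributions is set to 0
   by [\sum_(_ \in _) _]. *)
Definition summable (A : set K) (F : K -> mps V R) : Prop :=
  forall m, finite_set [set k | A k /\ mcoef (F k) m != 0]%classic.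

Definition fsum : set K -> (K -> mps V R) -> mps V R :=
  locked_with mps_key (fun A F => MPS (fun m => \sum_(k \in A) mcoef (F k) m)).

Lemma mcoef_fsum (A : set K) (F : K -> mps V R) m :
  mcoef (fsum A F) m = \sum_(k \in A) mcoef (F k) m.
Proof. by rewrite /fsum unlock. Qed.

End FormalSum.

Section Substitution.
Context {V : choiceType} {R : comNzRingType}.
Implicit Types (a : mps V R) (c : nat -> R).

Lemma summable_subst c a : mcoef a 1%M = 0 ->
  summable [set: nat]%classic (fun i => c i *: a ^+ i).
Proof.
move=> a0 m; apply: (@sub_finite_set _ _ `I_(mdeg m).+1); last exact: finite_II.
move=> i [_]; case: (ltnP (mdeg m) i) => [mi|//].
by rewrite mcoefZ mcoefX_lt ?mulr0 ?eqxx.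
Qed.

Lemma mcoef_subst1 c a : mcoef a 1%M = 0 ->
  mcoef (fsum [set: nat]%classic (fun i => c i *: a ^+ i)) 1%M = c 0%N.
Proof.
move=> a0; rewrite mcoef_fsum (fsbigE [:: 0%N]) //.
  rewrite big_cons big_nil ifT ?mem_set // Monoid.mulm1 mcoefZ expr0 mcoef1.
  by rewrite eqxx mulr1.
move=> [|i] _; rewrite inE // => _.
by rewrite mcoefZ mcoefX_lt ?mulr0 // mdeg1.
Qed.

Lemma mcoef_mpsX1 (v : V) : mcoef (mpsX v : mps V R) 1%M = 0.
Proof. by rewrite mpsXE mcoef_mpsM eq_sym cm1_eq1. Qed.

End Substitution.

(* The series with integer coefficients in x_1, x_2, ...; the variable
   x_(k+1) is [xvar k]. *)
Notation xseries := (mps nat int).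

Definition xvar (k : nat) : xseries := mpsX k.

(* h_n, e_n: sums over k_1 <= ... <= k_n, resp. k_1 < ... < k_n. *)
Definition hsym (n : nat) : xseries :=
  fsum [set u : {ffun 'I_n -> nat} |
          forall i j : 'I_n, (i <= j)%N -> (u i <= u j)%N]%classic
       (fun u => \prod_(i < n) xvar (u i)).

Definition esym (n : nat) : xseries :=
  fsum [set u : {ffun 'I_n -> nat} |
          forall i j : 'I_n, (i < j)%N -> (u i < u j)%N]%classic
       (fun u => \prod_(i < n) xvar (u i)).

(* H(a) and E(a), for a series a without constant term. *)
Definition Hser (V : choiceType) (a : mps V xseries) : mps V xseries :=
  fsum [set: nat]%classic (fun i => hsym i *: a ^+ i).

Definition Eser (V : choiceType) (a : mps V xseries) : mps V xseries :=
  fsum [set: nat]%classic (fun i => esym i *: a ^+ i).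

(* An element i of 'I_n.-1 stands for i+1 in [n-1]; [ord_fst i] and [ord_snd i]
   are then i+1 and i+2 seen in [n], i.e. the elements i and i+1 of 'I_n. *)
Definition ord_fst (n : nat) (i : 'I_n.-1) : 'I_n := widen_ord (leq_pred n) i.

Fact ord_snd_subproof (n : nat) (i : 'I_n.-1) : (i.+1 < n)%N.
Proof. by case: n i => [|n] [i]. Qed.

Definition ord_snd (n : nat) (i : 'I_n.-1) : 'I_n :=
  Ordinal (ord_snd_subproof i).

Definition Fqsym (n : nat) (T : {set 'I_n.-1}) : xseries :=
  fsum [set u : {ffun 'I_n -> nat} |
          (forall i j : 'I_n, (i <= j)%N -> (u j <= u i)%N) /\
          (forall j, j \in T -> (u (ord_snd j) < u (ord_fst j))%N)]%classic
       (fun u => \prod_(i < n) xvar (u i)).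

Lemma summable_words (n : nat) (A : set {ffun 'I_n -> nat}) :
  summable A (fun u => \prod_(i < n) xvar (u i)).
Proof.
move=> m; apply: (@sub_finite_set _ _
  ((fun f : {ffun 'I_n -> finsupp m} => [ffun i => val (f i)]) @` setT)%classic).
  move=> u [_]; rewrite /xvar; under eq_bigr do rewrite mpsXE.
  rewrite -mpsM_prod mcoef_mpsM => mE.
  have {}mE : m = \big[mmul/1%M]_(i < n) U_(u i)%M.
    by apply/eqP; move: mE; case: (m == _).
  have um i : u i \in finsupp m.
    by rewrite -cmE_neq0 mE (bigD1 i) //= cmM cmUU.
  by exists [ffun i => FSetSub (um i)] => //; apply/ffunP => i; rewrite !ffunE.
by apply: finite_image; exact: finite_finset.
Qed.

Lemma hsym0 : hsym 0 = 1.
Proof.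
apply: mpsP => m; rewrite mcoef_fsum (fsbigE [:: [ffun=> 0%N]]) //=.
- rewrite big_cons big_nil big_ord0 ifT ?Monoid.mulm1 //.
  by apply: mem_set => -[].
- by move=> u _ [].
move=> u _; rewrite inE; case: eqP => // -[]; by apply/ffunP => -[].
Qed.

Lemma mcoef_Hser1 (V : choiceType) (a : mps V xseries) :
  mcoef a 1%M = 0 -> mcoef (Hser a) 1%M = 1.
Proof. by move=> a0; rewrite mcoef_subst1 // hsym0. Qed.

(* The word with letters |pi_i| = pi.1 i and colors epsilon_i = pi.2 i.
   Positions and values are shifted by one: 'I_n stands for [n]. *)
Definition colperm (N n : nat) : Type := ('S_n * {ffun 'I_n -> 'I_N})%type.

HB.instance Definition _ (N n : nat) := Finite.on (colperm N n).

(* [(a, c)] is the letter (a+1)^c. *)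
Definition letter : Type := (nat * nat)%type.

Definition letter_lt (a b : letter) : bool :=
  (b.2 < a.2)%N || ((a.2 == b.2) && (a.1 < b.1)%N).

(* [(true, a)] is the letter a with a tilde. *)
Definition tletter_lt (a b : bool * letter) : bool :=
  if a.1 == b.1 then letter_lt a.2 b.2 else a.1.

Section Statistics.
Context {N n : nat}.
Implicit Types p : colperm N n.

Definition word p (i : 'I_n) : letter := (val (p.1 i), val (p.2 i)).

Definition EXC p : {set 'I_n} := [set i : 'I_n | letter_lt (val i, 0%N) (word p i)].

Definition exc p : nat := #|EXC p|.

Definition fixv p : {ffun 'I_N -> nat} :=
  [ffun k : 'I_N => #|[set i : 'I_n | word p i == (val i, val k)]|].

(* The entry at m : 'I_N.-1 is col_(m+1). *)
Definition colv p : {ffun 'I_N.-1 -> nat} :=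
  [ffun m : 'I_N.-1 => #|[set i : 'I_n | p.2 i == ord_snd m]|].

Definition tword p (i : 'I_n) : bool * letter := (i \in EXC p, word p i).

Definition DEX p : {set 'I_n.-1} :=
  [set i : 'I_n.-1 | tletter_lt (tword p (ord_snd i)) (tword p (ord_fst i))].

End Statistics.

Definition Qsym (N n j : nat) (al : {ffun 'I_N -> nat})
    (be : {ffun 'I_N.-1 -> nat}) : xseries :=
  \sum_(p : colperm N n | [&& exc p == j, fixv p == al & colv p == be])
     Fqsym (DEX p).

(* z, t, r_0, ..., r_(N-1), s_1, ..., s_(N-1); [Svar m] is s_(m+1). *)
Inductive gvar (N : nat) :=
  Zvar | Tvar | Rvar of 'I_N | Svar of 'I_N.-1.
Arguments Zvar {N}.
Arguments Tvar {N}.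

HB.instance Definition _ (N : nat) := gen_eqMixin (gvar N).
HB.instance Definition _ (N : nat) := gen_choiceMixin (gvar N).

(* The ring Z[[x_1, x_2, ...]][[z, t, r, s]].  It contains the power series in z
   whose coefficients are polynomials in t, r, s, and 1 - t is invertible in it,
   so that the quotient by a series with constant coefficient 1 - t in z makes
   sense. *)
Notation gseries N := (mps (gvar N) xseries).

Definition gz {N : nat} : gseries N := mpsX Zvar.
Definition gt {N : nat} : gseries N := mpsX Tvar.
Definition gr {N : nat} (c : 'I_N) : gseries N := mpsX (Rvar c).
Definition gs {N : nat} (m : 'I_N.-1) : gseries N := mpsX (Svar m).

Lemma denominator_unit (N : nat) :
  (1 + \sum_(m < N.-1) gs m) * Hser (gt * gz)
    - (gt + \sum_(m < N.-1) gs m) * Hser gz \is a @GRing.unit (gseries N).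
Proof.
have tz0 : mcoef (gt * gz : gseries N) 1%M = 0.
  by rewrite mcoefM1 mcoef_mpsX1 mul0r.
have s0 : mcoef (\sum_(m < N.-1) gs m : gseries N) 1%M = 0.
  by rewrite mcoef_sum big1 // => m _; rewrite mcoef_mpsX1.
rewrite mps_unitE mcoefB !mcoefM1 !mcoefD s0 !mcoef_Hser1 ?mcoef_mpsX1 //.
by rewrite mcoef1 eqxx !addr0 !mulr1 subr0 unitr1.
Qed.

Section Exponents.
Variable (N : nat).
Implicit Types (v w : gvar N) (m : {cmonom gvar N}).

Let cm_prod (I : finType) (F : I -> {cmonom gvar N}) w :
  (\big[mmul/1%M]_i F i) w = (\sum_i F i w)%N.
Proof.
apply: (big_morph (fun m : {cmonom gvar N} => m w)) => [m1 m2|].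
  exact: cmM.
exact: cm1.
Qed.

Let monom_power : exists pw : gvar N -> nat -> {cmonom gvar N},
  (forall v k w, pw v k w = ((v == w) * k)%N) /\
  (forall v k, mpsM (pw v k) = mpsX v ^+ k :> gseries N).
Proof.
exists (fun v k => \big[mmul/1%M]_(i < k) U_(v)%M); split=> [v k w|v k].
  by rewrite cm_prod sum_nat_const card_ord cmU mulnC.
by rewrite mpsMX mpsXE.
Qed.

Lemma summable_gf : summable
  [set: nat * nat * {ffun 'I_N -> nat} * {ffun 'I_N.-1 -> nat}]%classic
  (fun '(n, j, al, be) => Qsym n j al be *:
     (gz ^+ n * gt ^+ j * \prod_(c < N) gr c ^+ al c
        * \prod_(m < N.-1) gs m ^+ be m)).
Proof.
have [pw [pwE pwM]] := monom_power.
move=> m; apply: (@sub_finite_set _ _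
  [set (m Zvar, m Tvar, [ffun c => m (Rvar c)], [ffun k => m (Svar k)])]%classic);
  last exact: finite_set1.
move=> [[[n j] al] be] [_]; rewrite mcoefZ.
have -> : gz ^+ n * gt ^+ j * \prod_(c < N) gr c ^+ al c
    * \prod_(k < N.-1) gs k ^+ be k = mpsM (pw Zvar n * pw Tvar j
    * (\big[mmul/1]_(c < N) pw (Rvar c) (al c))
    * (\big[mmul/1]_(k < N.-1) pw (Svar k) (be k)))%M :> gseries N.
  by rewrite !mpsMM !pwM !mpsM_prod;
    congr (_ * _ * _ * _); apply: eq_bigr => c _; rewrite pwM.
rewrite mcoef_mpsM; set mon := (_ * _)%M.
have [-> _ /=|_] := m =P mon; last by rewrite mulr0 eqxx.
rewrite {}/mon.
have eR (c d : 'I_N) : (Rvar c == Rvar d) = (c == d).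
  by apply/eqP/eqP => [[]|->].
have eS (c d : 'I_N.-1) : (Svar c == Svar d) = (c == d).
  by apply/eqP/eqP => [[]|->].
have ne v w : v <> w -> (v == w) = false by move=> vw; apply/eqP.
congr (_, _, _, _).
- rewrite !cmM !cm_prod !pwE eqxx mul1n ne // !big1 ?addn0 // => c _;
  by rewrite pwE ne.
- rewrite !cmM !cm_prod !pwE eqxx mul1n ne // !big1 ?addn0 // => c _;
  by rewrite pwE ne.
- apply/ffunP => d; rewrite ffunE !cmM !cm_prod !pwE ne // ne //.
  rewrite [X in (_ + _ + _ + X)%N]big1 => [|c _]; last by rewrite pwE ne.
  rewrite (bigD1 d) //= pwE eqxx mul1n big1 ?addn0 // => c /negPf cd.
  by rewrite pwE eR cd.
apply/ffunP => d; rewrite ffunE !cmM !cm_prod !pwE ne // ne //.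
rewrite [X in (_ + _ + X + _)%N]big1 => [|c _]; last by rewrite pwE ne.
rewrite (bigD1 d) //= pwE eqxx mul1n big1 ?addn0 // => c /negPf cd.
by rewrite pwE eS cd.
Qed.

End Exponents.

(* Main.v *)
(* Idea.  A fundamental quasisymmetric function is the sum of the weakly
   decreasing words U compatible with the descents, so the left-hand side
   counts pairs (pi, U) such that pi has no DEX-descent inside a block of equal
   letters of U.

   Fixed points: inside a block, the letters of a given color are increasing,
   so pi_i - i is weakly increasing there, and fixed points of that color can
   be removed, and inserted back at a unique place.  Hence a block k and a color
   c contribute a factor 1 / (1 - r_c s_c x_k z), and it suffices to know the
   sum with all r_c = 1.

   That sum: label each value v by the block k = U_i of its position i in pi and
   by its type (excedance, or color).  The compatible pi become the words in
   these labels in which each block k is used as often as it occurs in U,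
   subject to local conditions only: a non-excedance v of color 0 has k <= U_v,
   an excedance has k >= U_v, with equality excluded when v is the first element
   of its block.  With al = 1 + sum s_m and be = t + sum s_m, let
     Q_j = al (y_0 + ... + y_(j-1)) + be (y_j + y_(j+1) + ...).
   Marking the label k by y_k, the first element of block k has weight Q_(k+1),
   the others have weight Q_k + y_k = Q_(k+1) + t y_k, and the number of elements
   of block k has to be the exponent of y_k.  If G is the series where all
   elements of block k have weight Q_k + y_k, then multiplying G by
   prod_k (1 - a x_k) replaces one factor of each block k by Q_k + y_k - a y_k,
   that is Q_k for a = 1 and Q_(k+1) for a = t.  Now
   al prod Q_k = be prod Q_(k+1), as Q_0 = be sum y and Q_K = al sum y; hence
     (al prod_k (1 - x_k) - be prod_k (1 - t x_k)) G = 1 - t. *)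
From HB Require Import structures.
Require Import Defs.
From mathcomp Require Import all_boot all_order all_algebra all_fingroup finmap.
From mathcomp Require Import boolp classical_sets functions fsbigop.
From mathcomp Require Import monalg zify ring.
Set Implicit Arguments.
Unset Strict Implicit.
Unset Printing Implicit Defensive.
Import GRing.Theory.
Local Open Scope ring_scope.

Local Notation "1" := (@mone _) : monom_scope.
Local Notation "x * y" := (mmul x y) : monom_scope.
Local Notation "'U_(' i )" := (@ucm _ i) : monom_scope.

(** * Compatibility with the descents *)

Section Compatible.
Context {N n : nat}.
Implicit Types (p : colperm N n) (U : 'I_n -> nat).

Lemma in_EXC p i : (i \in EXC p) = (p.2 i == 0%N :> nat) && (i < p.1 i)%N.
Proof. by rewrite inE /letter_lt /word /= eq_sym. Qed.

(* The letters of a block are sorted by section: excedances, then colors N-1,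
   ..., 1, then non-excedances of color 0; inside a section, by value. *)
Definition sect p i : nat := if i \in EXC p then 0%N else (N - p.2 i)%N.

Definition sect_lt p i j :=
  (sect p i < sect p j)%N || (sect p i == sect p j) && (p.1 i < p.1 j)%N.

(** The order with tildes is lexicographic in section and value: a larger color gives a smaller
    letter, and [N - p.2 i] is positive, so that section 0 holds the tilded letters only. *)
Lemma tletter_ltE p i j :
  tletter_lt (tword p i) (tword p j) = sect_lt p i j.
Proof.
rewrite /tletter_lt /sect_lt /tword /sect /= /letter_lt /word /=.
have := ltn_ord (p.2 i); have := ltn_ord (p.2 j).
rewrite !in_EXC; case: (altP (p.2 i =P 0%N :> nat)) => [->|];
  case: (altP (p.2 j =P 0%N :> nat)) => [->|];
  rewrite /=; case: (i < p.1 i)%N; case: (j < p.1 j)%N => /=; lia.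
Qed.

Lemma sect_lt_trans p : transitive (sect_lt p).
Proof. by move=> j i k; rewrite /sect_lt; lia. Qed.

(** [U] is the index word of a monomial; a block is a set of positions with equal index. *)
Definition compat U p :=
  [forall i : 'I_n, forall j : 'I_n, (i < j)%N && (U i == U j) ==> sect_lt p i j].

Lemma compatP U p : reflect
  (forall i j : 'I_n, (i < j)%N -> U i = U j -> sect_lt p i j) (compat U p).
Proof.
apply: (iffP forallP) => [H i j ij e|H i].
  by have /forallP/(_ j)/implyP := H i; apply; rewrite ij e eqxx.
by apply/forallP => j; apply/implyP => /andP[ij /eqP]; exact: H.
Qed.

Definition decr U := forall i j : 'I_n, (i <= j)%N -> (U j <= U i)%N.

(** The blocks of a weakly decreasing word are intervals. Distinct values make a non-descent between
    neighbours strict, and transitivity of [sect_lt] carries it through the block. *)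
Lemma DEX_compat U p : decr U ->
  (forall j, j \in DEX p -> (U (ord_snd j) < U (ord_fst j))%N) <-> compat U p.
Proof.
move=> dU; split=> [H|/compatP H j]; last first.
  rewrite inE tletter_ltE => jD; rewrite ltn_neqAle dU ?andbT //=.
  apply/eqP => e; have := H (ord_fst j) (ord_snd j) (ltnSn _) (esym e).
  by move: jD; rewrite /sect_lt; lia.
have step (i j : 'I_n) : j = i.+1 :> nat -> U i = U j -> sect_lt p i j.
  move=> ji Uij; have in1 : (i < n.-1)%N by have := ltn_ord j; lia.
  have ei : ord_fst (Ordinal in1) = i by apply: val_inj.
  have ej : ord_snd (Ordinal in1) = j by apply: val_inj; rewrite /= ji.
  have := H (Ordinal in1); rewrite inE tletter_ltE ei ej Uij ltnn => {}H.
  have Nji : ~~ sect_lt p j i by apply/negP => /H.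
  have pij : (p.1 i != p.1 j :> nat).
    by apply/eqP => /val_inj/perm_inj e; move: ji; rewrite e; lia.
  by move: Nji pij; rewrite /sect_lt; lia.
apply/compatP => i j ij Uij; have [k kE] := ubnP (j - i)%N.
elim: k i ij Uij kE => // k IHk i ij Uij kE.
have i1n : (i.+1 < n)%N by have := ltn_ord j; lia.
have U1 : U (Ordinal i1n) = U j.
  apply/eqP; rewrite eqn_leq -{1}Uij !dU //.
have /step/(_ _) s1 : Ordinal i1n = i.+1 :> nat by [].
have {}s1 := s1 (etrans Uij (esym U1)).
have [e|ne] := eqVneq (i.+1 : nat) j.
  by rewrite (_ : j = Ordinal i1n) //; apply: val_inj.
by apply: sect_lt_trans s1 _; apply: IHk => //=; lia.
Qed.

End Compatible.

(** * Removing and inserting fixed points *)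

Lemma down_closed_cut n (P : pred 'I_n) :
  (forall j k : 'I_n, (j <= k)%N -> P k -> P j) ->
  exists i : 'I_n.+1, forall j : 'I_n, (j < i)%N = P j.
Proof.
move=> dP.
pose Q m := [forall j : 'I_n, (m <= j)%N ==> ~~ P j].
have exQ : exists m, Q m.
  by exists n; apply/forallP => j; rewrite leqNgt ltn_ord.
have [m /forallP Qm min_m] := ex_minnP exQ.
have mn : (m < n.+1)%N.
  by rewrite ltnS min_m //; apply/forallP => j; rewrite leqNgt ltn_ord.
exists (Ordinal mn) => j /=; case: ltnP => [jm|mj]; last first.
  by have /implyP/(_ mj)/negPf := Qm j.
apply/esym; case: m => // m in Qm min_m mn jm *.
have : ~~ Q m by apply/negP => /min_m; rewrite ltnn.
by move=> /forallPn[k]; rewrite negb_imply negbK => /andP[mk]; apply: dP; lia.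
Qed.

Section Weight.
Context {N : nat} {S : comNzRingType}.
Variables (t : S) (s : 'I_N -> S).

(** The variable [r] may depend on the block, so that fixed points can be switched off for one block
    and one color at a time. *)
Definition weight n (r : nat -> 'I_N -> S) (U : 'I_n -> nat)
    (p : colperm N n) : S :=
  \prod_i ((if i \in EXC p then t else 1) * s (p.2 i)
            * (if p.1 i == i then r (U i) (p.2 i) else 1)).

Definition compat_sum n r (U : 'I_n -> nat) : S :=
  \sum_(p : colperm N n | compat U p) weight r U p.

Section Insertion.
Context {n : nat} (c : 'I_N).
Implicit Types (i : 'I_n.+1) (j k : 'I_n) (p : colperm N n)
  (q : colperm N n.+1).

(** Positions and values are both shifted by [lift i], so that the other letters keep their
    sections, their order and the property of being fixed. *)
Definition insert i p : colperm N n.+1 :=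
  (lift_perm i i p.1, [ffun k => if unlift i k is Some j then p.2 j else c]).

Lemma insert_id i p : (insert i p).1 i = i.
Proof. exact: lift_perm_id. Qed.
Lemma insert_lift i p j : (insert i p).1 (lift i j) = lift i (p.1 j).
Proof. exact: lift_perm_lift. Qed.
Lemma insert_color i p : (insert i p).2 i = c.
Proof. by rewrite ffunE unlift_none. Qed.
Lemma insert_color_lift i p j : (insert i p).2 (lift i j) = p.2 j.
Proof. by rewrite ffunE liftK. Qed.
Definition insertE := (insert_id, insert_lift, insert_color, insert_color_lift).

Lemma ltn_lift i j k : (lift i j < lift i k)%N = (j < k)%N.
Proof. by rewrite /lift /= /bump; lia. Qed.

Lemma insert_EXC i p : (i \in EXC (insert i p)) = false.
Proof. by rewrite in_EXC insert_id ltnn andbF. Qed.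
Lemma insert_EXC_lift i p j : (lift i j \in EXC (insert i p)) = (j \in EXC p).
Proof. by rewrite !in_EXC !insertE ltn_lift. Qed.

Lemma insert_sect i p : sect (insert i p) i = (N - c)%N.
Proof. by rewrite /sect insert_EXC insertE. Qed.
Lemma insert_sect_lift i p j : sect (insert i p) (lift i j) = sect p j.
Proof. by rewrite /sect insert_EXC_lift insertE. Qed.

(** The default permutation is reached only when [q.1] does not fix [i]. *)
Definition delete i q : colperm N n :=
  (odflt 1%g [pick w : 'S_n | lift_perm i i w == q.1],
   [ffun j => q.2 (lift i j)]).

Lemma lift_perm_inj i : injective (lift_perm i i).
Proof.
move=> v w e; apply/permP => j; apply: (@lift_inj _ i).
by rewrite -!(lift_perm_lift i i) e.
Qed.

Lemma insertK i : cancel (insert i) (delete i).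
Proof.
move=> [w d]; congr pair.
  case: pickP => [v /eqP /lift_perm_inj//|/(_ w)]; by rewrite eqxx.
by apply/ffunP => j; rewrite ffunE insertE.
Qed.

Lemma deleteK i q : q.1 i = i -> q.2 i = c -> insert i (delete i q) = q.
Proof.
case: q => w d /= wi di; rewrite /insert /=; congr pair; last first.
  apply/ffunP => k; rewrite !ffunE; case: unliftP => [j ->|->] //=.
  by rewrite ffunE.
(* As [w] fixes [i], the value [w (lift i j)] is never [i], and [f] is the map induced on the other
   values. *)
case: pickP => [v /eqP//|]; pose f j := odflt j (unlift i (w (lift i j))).
have fE j : lift i (f j) = w (lift i j).
  rewrite /f; case: unliftP => //= wij; case/eqP: (neq_lift i j).
  by apply: (@perm_inj _ w); rewrite wi wij.
have f_inj : injective f.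
  by move=> j k e; apply: (@lift_inj _ i); apply: (@perm_inj _ w);
    rewrite -!fE e.
move/(_ (perm f_inj)) => /eqP[]; apply/permP => k.
case: (unliftP i k) => [j ->|->]; rewrite ?lift_perm_id ?wi //.
by rewrite lift_perm_lift permE fE.
Qed.

Lemma liftE i j : lift i j = ((i <= j) + j)%N :> nat.
Proof. by []. Qed.

Section Block.
Variables (r : nat -> 'I_N -> S) (U : 'I_n.+1 -> nat) (U' : 'I_n -> nat).
Variable kap : nat.
Hypothesis dU : decr U.
(** Required for every [i] of the block, because the place of insertion depends on the
    permutation. *)
Hypothesis U'E : forall i, U i = kap -> forall j, U' j = U (lift i j).
Hypothesis kapU : exists i, U i = kap.

Definition fixed_at q i := [&& U i == kap, q.1 i == i & q.2 i == c].
Definition first_fixed q i :=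
  fixed_at q i && [forall k : 'I_n.+1, (k < i)%N ==> ~~ fixed_at q k].

(* The letters of the block that precede the first fixed point of color [c]:
   adjacent letters j, j+1 of one section satisfy p_(j+1) - (j+1) >= p_j - j. *)
Let before p j := (kap < U' j)%N || (U' j == kap) &&
  ((sect p j < N - c)%N || (sect p j == N - c)%N && (p.1 j < j)%N).

Let dU' : decr U'.
Proof.
case: kapU => i Ui j k jk; rewrite !(U'E Ui) dU //.
by rewrite /lift /= leq_bump2.
Qed.

(** The place of insertion is forced: to its left the letters of the block in section [N - c] have
    values below their positions, from it on they have values at or above them. So [i] is the number
    of positions satisfying [before p]. *)
Let insert_first i p : U i = kap ->
  compat U (insert i p) && first_fixed (insert i p) i =
  compat U' p && [forall j : 'I_n, (j < i)%N == before p j].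
Proof.
move=> Ui; have lt_lift (j k : 'I_n) : (lift i j < lift i k)%N = (j < k)%N.
  exact: ltn_lift.
apply/idP/idP.
  case/andP => /compatP cU /andP[_ /forallP mi].
  have cU' : compat U' p.
    apply/compatP => j k jk; rewrite !(U'E Ui) => e.
    have := cU (lift i j) (lift i k); rewrite lt_lift => /(_ jk e).
    by rewrite /sect_lt !insert_sect_lift !insertE lt_lift.
  rewrite cU' /=; move/compatP: cU' => cU'.
  have lo (j : 'I_n) : (j < i)%N -> U' j = kap ->
      (sect p j < N - c)%N || (sect p j == N - c)%N && (p.1 j < i)%N.
    move=> ji e; have := cU (lift i j) i.
    rewrite -(U'E Ui) Ui /sect_lt insert_sect_lift insert_sect insert_lift.
    rewrite insert_id !liftE => /(_ _ e); lia.
  have hi (j : 'I_n) : (i <= j)%N -> U' j = kap ->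
      (N - c < sect p j)%N || (sect p j == N - c)%N && (i <= p.1 j)%N.
    move=> ij e; have := cU i (lift i j).
    rewrite -(U'E Ui) Ui /sect_lt insert_sect_lift insert_sect insert_lift.
    rewrite insert_id !liftE => /(_ _ (esym e)); lia.
  have nofix (j : 'I_n) : (j < i)%N -> U' j = kap -> sect p j = (N - c)%N ->
      p.1 j != j :> nat.
    move=> ji Uj sj; have /implyP := mi (lift i j); rewrite liftE.
    have -> : ((i <= j) + j < i)%N by lia.
    move=> /(_ isT); rewrite /fixed_at -(U'E Ui) Uj eqxx insert_lift
      insert_color_lift.
    rewrite (inj_eq lift_inj) /=; apply: contra => /eqP pj.
    apply/andP; split; first by apply/eqP/val_inj.
    apply/eqP/val_inj => /=; move: sj; rewrite /sect in_EXC pj ltnn andbF.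
    by have := ltn_ord c; have := ltn_ord (p.2 j); lia.
  (* Downward induction from [i]: the letter just before [i] has value at most its position and is
     not fixed; one step further left the value drops by at least 1. *)
  have below (j : 'I_n) : (j < i)%N -> U' j = kap -> sect p j = (N - c)%N ->
      (p.1 j < j)%N.
    have [k kE] := ubnP (i - j)%N; elim: k j kE => // k IHk j kE ji Uj sj.
    have [e|ne] := eqVneq (i : nat) j.+1.
      by have := lo j ji Uj; have := nofix j ji Uj sj; rewrite sj; lia.
    have j1n : (j.+1 < n)%N by have := ltn_ord i; lia.
    have j1i : (Ordinal j1n < i)%N by rewrite /=; lia.
    have U1 : U' (Ordinal j1n) = kap.
      apply/eqP; rewrite eqn_leq -{1}Uj dU' ?leqnSn //=.
      by rewrite (U'E Ui) -{1}Ui dU // liftE /=; lia.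
    have := cU' j (Ordinal j1n) (ltnSn _) (etrans Uj (esym U1)).
    have := lo _ j1i U1; have := IHk (Ordinal j1n) _ j1i U1.
    by rewrite /sect_lt sj /=; lia.
  (* Upward induction from [i]: values increase strictly within a section, so the inequality passes
     to the next position. *)
  have above (j : 'I_n) : (i <= j)%N -> U' j = kap -> sect p j = (N - c)%N ->
      (j <= p.1 j)%N.
    have [k kE] := ubnP j; elim: k j kE => // k IHk j kE ij Uj sj.
    have [e|ne] := eqVneq (i : nat) j.
      by have := hi j ij Uj; rewrite sj; lia.
    have j1n : (j.-1 < n)%N by have := ltn_ord j; lia.
    have ij1 : (i <= Ordinal j1n)%N by rewrite /=; lia.
    have U1 : U' (Ordinal j1n) = kap.
      apply/eqP; rewrite eqn_leq -{2}Uj dU' ?leq_pred ?andbT //=.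
      by rewrite (U'E Ui) -[leqRHS]Ui dU // liftE /=; lia.
    have := cU' (Ordinal j1n) j _ (etrans U1 (esym Uj)).
    have := hi _ ij1 U1; have := IHk (Ordinal j1n) _ ij1 U1.
    by rewrite /sect_lt sj /=; lia.
  apply/forallP => j; apply/eqP; rewrite /before; case: (ltnP j i) => ji.
    have : (kap <= U' j)%N by rewrite (U'E Ui) -{1}Ui dU // liftE; lia.
    rewrite leq_eqVlt => /orP[/eqP e|->//]; rewrite -e ltnn eqxx /=.
    by have := lo j ji (esym e); have := below j ji (esym e); lia.
  have : (U' j <= kap)%N by rewrite (U'E Ui) -[leqRHS]Ui dU // liftE; lia.
  rewrite leq_eqVlt => /orP[/eqP e|Uj]; last by lia.
  by rewrite e ltnn eqxx /=; have := hi j ji e; have := above j ji e; lia.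
case/andP => /compatP cU' /forallP bef; have {}bef j := eqP (bef j).
have {}bef (j : 'I_n) : U' j = kap -> (j < i)%N = (sect p j < N - c)%N
    || (sect p j == N - c)%N && (p.1 j < j)%N.
  by move=> e; rewrite bef /before e ltnn eqxx.
apply/andP; split.
  apply/compatP => a b; case: (unliftP i a) => [j ->|->];
    case: (unliftP i b) => [k ->|->]; rewrite ?ltnn // ?lt_lift -?(U'E Ui) ?Ui;
    rewrite /sect_lt ?insert_sect_lift ?insert_sect ?insert_lift ?insert_id //.
  - by rewrite lt_lift => jk e; have := cU' j k jk e.
  - by move=> ji /bef; move: ji; rewrite !liftE; lia.
  by move=> ik /esym/bef; move: ik; rewrite !liftE; lia.
rewrite /first_fixed /fixed_at Ui insert_id insert_color !eqxx /=.
apply/forallP => k; apply/implyP; case: (unliftP i k) => [j ->|->]; last first.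
  by rewrite ltnn.
rewrite -(U'E Ui) insert_lift insert_color_lift (inj_eq lift_inj) => ji.
apply/negP => /and3P[/eqP/bef Uj /eqP pj /eqP cj]; move: Uj ji.
by rewrite /sect in_EXC pj cj ltnn andbF liftE; lia.
Qed.

(** One position to the left within the block, either the section drops, or the value drops by at
    least as much as the position. *)
Let before_down p : compat U' p ->
  forall j k : 'I_n, (j <= k)%N -> before p k -> before p j.
Proof.
move=> /compatP cU' j k; have [m mE] := ubnP (k - j)%N.
elim: m j mE => // m IHm j mE jk bk; have [e|ne] := eqVneq (j : nat) k.
  by rewrite (val_inj e : j = k).
have j1n : (j.+1 < n)%N by have := ltn_ord k; lia.
have {IHm}: before p (Ordinal j1n) by apply: IHm; rewrite //=; lia.
have := cU' j (Ordinal j1n) (ltnSn _);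
  have := dU' (leqnSn j : (j <= Ordinal j1n)%N).
by rewrite /before /sect_lt /=; lia.
Qed.

(** [before p] holds where [U' > kap] and fails where [U' < kap]; the additional letter [kap] of [U]
    makes the cut a position of the block even at its end. *)
Let cut_block i p : (forall j : 'I_n, (j < i)%N = before p j) -> U i = kap.
Proof.
move=> bef; have [i0 Ui0] := kapU.
have [e|lt|lt] := ltngtP (U i) kap => //.
- have ii : (i0 < i)%N by rewrite ltnNge; apply/negP => /dU; lia.
  have i1n : (i.-1 < n)%N by have := ltn_ord i; lia.
  have := bef (Ordinal i1n); rewrite /before (U'E Ui0).
  rewrite (_ : lift i0 _ = i) /=; first by lia.
  by apply: val_inj => /=; rewrite /bump; lia.
have ii : (i < i0)%N by rewrite ltnNge; apply/negP => /dU; lia.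
have i1n : (i < n)%N by have := ltn_ord i0; lia.
have := bef (Ordinal i1n); rewrite /before (U'E Ui0).
rewrite (_ : lift i0 _ = i) /=; first by lia.
by apply: val_inj => /=; rewrite /bump; lia.
Qed.

Lemma weight_insert i p : U i = kap ->
  weight r U (insert i p) = s c * r kap c * weight r U' p.
Proof.
move=> Ui; rewrite /weight (bigD1_ord i) //=; congr (_ * _).
  by rewrite insert_EXC lift_perm_id eqxx insert_color Ui mul1r.
apply: eq_bigr => j _.
by rewrite insert_EXC_lift insert_color_lift lift_perm_lift (inj_eq lift_inj)
  (U'E Ui).
Qed.

(** Removing the first fixed point of color [c] in block [kap] is a bijection onto the permutations
    compatible with [U'], as there is exactly one place to put it back. *)
Lemma compat_sum_fixed :
  \sum_(q : colperm N n.+1 | compat U q && [exists i, fixed_at q i])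
     weight r U q
  = s c * r kap c * compat_sum r U'.
Proof.
(* The inner sum over first fixed points has one term if a fixed point exists, and none
   otherwise. *)
transitivity (\sum_(q : colperm N n.+1)
    \sum_(i | compat U q && first_fixed q i) weight r U q).
  rewrite big_mkcond; apply: eq_bigr => q _.
  case: (boolP (compat U q)) => /= cq; last by rewrite big_pred0.
  case: existsP => [[i fi]|nofix]; last first.
    by rewrite big_pred0 // => i; apply/negP => /andP[fi _]; apply: nofix;
      exists i.
  have exf : exists m, [exists i : 'I_n.+1, (i == m :> nat) && fixed_at q i].
    by exists i; apply/existsP; exists i; rewrite eqxx.
  have [m /existsP[k /andP[/eqP km fk]] min_m] := ex_minnP exf.
  rewrite (big_pred1 k) // => a; apply/idP/eqP => [/andP[fa /forallP la]|->].
    apply/ord_inj/eqP; rewrite eqn_leq; apply/andP; split.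
      by rewrite leqNgt; apply/negP => ka; have := la k; rewrite ka fk.
    by rewrite km min_m //; apply/existsP; exists a; rewrite eqxx.
  rewrite /first_fixed fk; apply/forallP => b; apply/implyP => bk.
  apply/negP => fb; move: bk; rewrite ltnNge km min_m //.
  by apply/existsP; exists b; rewrite eqxx.
rewrite (exchange_big_dep predT) //=.
transitivity (\sum_i \sum_(p | [&& U i == kap, compat U' p &
    [forall j : 'I_n, (j < i)%N == before p j]]) s c * r kap c * weight r U' p).
  apply: eq_bigr => i _; case: (eqVneq (U i) kap) => /= [Ui|/negPf Ui];
    last first.
    by rewrite !big_pred0 // => q; rewrite /first_fixed /fixed_at Ui andbF.
  rewrite (reindex_onto (insert i) (delete i)) /=; last first.
    by move=> q /andP[_ /andP[/and3P[_ /eqP qi /eqP qc] _]]; exact: deleteK.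
  apply: eq_big => [p|p _]; last exact: weight_insert.
  by rewrite insertK eqxx andbT insert_first.
rewrite (exchange_big_dep (compat U')) /=; last by move=> i p _ /and3P[].
rewrite /compat_sum mulr_sumr; apply: eq_bigr => p cp.
have [i bi] := down_closed_cut (before_down cp).
rewrite (big_pred1 i) // => a; rewrite cp /=.
apply/andP/eqP => [[_ /forallP ba]|->]; last first.
  by rewrite (cut_block bi); split=> //; apply/forallP => j; rewrite bi.
have {}ba j := eqP (ba j).
apply/ord_inj/eqP; rewrite eqn_leq; apply/andP; split.
  rewrite leqNgt; apply/negP => ia.
  have i1n : (i < n)%N by have := ltn_ord a; lia.
  by have := ba (Ordinal i1n); rewrite -bi /= ia ltnn.
rewrite leqNgt; apply/negP => ai.
have a1n : (a < n)%N by have := ltn_ord i; lia.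
by have := ba (Ordinal a1n); rewrite -bi /= ai ltnn.
Qed.

End Block.
End Insertion.

Definition unfix (r : nat -> 'I_N -> S) (kap : nat) (c : 'I_N) :
    nat -> 'I_N -> S :=
  fun k d => if (k == kap) && (d == c) then 0 else r k d.

Lemma weight_unfix n r (U : 'I_n -> nat) kap c (p : colperm N n) :
  weight (unfix r kap c) U p =
  if [exists i, [&& U i == kap, p.1 i == i & p.2 i == c]] then 0
  else weight r U p.
Proof.
case: existsP => [[i /and3P[/eqP Ui pi ci]]|nofix].
  by rewrite /weight (bigD1 i) //= pi /unfix Ui eqxx ci mulr0 mul0r.
apply: eq_bigr => i _; congr (_ * _); case: ifP => // pi; rewrite /unfix.
by case: ifP => // /andP[Ui ci]; case: nofix; exists i; rewrite Ui pi.
Qed.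

(** The permutations are split according to whether block [kap] has a fixed point of color [c]. On
    generating series this recurrence becomes multiplication by a linear factor. *)
Lemma compat_sum_unfix n r (U : 'I_n.+1 -> nat) (U' : 'I_n -> nat) kap c :
  decr U -> (forall i, U i = kap -> forall j, U' j = U (lift i j)) ->
  (exists i, U i = kap) ->
  compat_sum r U = compat_sum (unfix r kap c) U + s c * r kap c * compat_sum r U'.
Proof.
move=> dU U'E kapU; rewrite -(compat_sum_fixed c r dU U'E kapU) /compat_sum.
rewrite (bigID (fun q : colperm N n.+1 => [exists i, fixed_at c U kap q i])) /=.
rewrite addrC; congr (_ + _);
  rewrite [RHS](eq_bigr _ (fun q _ => weight_unfix r U kap c q)).
rewrite [RHS](bigID (fun q : colperm N n.+1 =>
  [exists i, fixed_at c U kap q i])) /=.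
rewrite [X in _ = X + _]big1 ?add0r => [|q /andP[_]];
  last by rewrite /fixed_at => ->.
by apply: eq_bigr => q /andP[_ /negPf]; rewrite /fixed_at => ->.
Qed.

Lemma compat_sum_nofix n r (U : 'I_n -> nat) kap c :
  (forall i, U i != kap) -> compat_sum (unfix r kap c) U = compat_sum r U.
Proof.
move=> Uk; apply: eq_bigr => p _; rewrite weight_unfix; case: existsP => //.
by move=> [i]; rewrite (negPf (Uk i)).
Qed.

End Weight.

(** * Permutations as words *)

Section SortingPermutation.
Context {n : nat} (f : 'I_n -> nat).
Hypothesis f_inj : injective f.

Let rank (x : 'I_n) := #|[set y | (f y < f x)%N]|.

Let rank_le x y : (f x <= f y)%N -> (rank x <= rank y)%N.
Proof.
by move=> xy; apply/subset_leq_card/fintype.subsetP => z;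
  rewrite !inE => /leq_trans; apply.
Qed.

Let rank_lt x y : (f x < f y)%N -> (rank x < rank y)%N.
Proof.
move=> xy; apply: proper_card; apply/properP; split.
  by apply/fintype.subsetP => z; rewrite !inE => /ltn_trans; apply.
by exists x; rewrite !inE ?ltnn.
Qed.

Let rank_inj : injective rank.
Proof.
move=> x y e; apply: f_inj; have [||//] := ltngtP (f x) (f y) => /rank_lt;
by rewrite e ltnn.
Qed.

Definition sorts (w : 'S_n) :=
  forall a b : 'I_n, (a < b)%N -> (f (w a) < f (w b))%N.

Let rank_sorted w a : sorts w -> rank (w a) = a.
Proof.
move=> sw; rewrite /rank -(card_preimset _ (@perm_inj _ w)).
have -> : w @^-1: [set y | (f y < f (w a))%N] = [set b : 'I_n | (b < a)%N].
  apply/setP => b; rewrite !inE; have [ba|ab|/val_inj->] := ltngtP b a.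
  - exact: sw.
  - by apply/negbTE; rewrite -leqNgt ltnW // sw.
  by rewrite ltnn.
transitivity (\sum_(b < n | (b < a)%N) 1)%N.
  by rewrite -sum1_card; apply: eq_bigl => b; rewrite inE.
by rewrite -(big_ord_widen n (fun=> 1%N) (ltnW (ltn_ord a))) sum1_card card_ord.
Qed.

Lemma sorts_uniq v w : sorts v -> sorts w -> v = w.
Proof. by move=> sv sw; apply/permP => a; apply: rank_inj;
  rewrite !rank_sorted. Qed.

Lemma sorts_exists : exists w, sorts w.
Proof.
have rn x : (rank x < n)%N.
  rewrite -[X in (_ < X)%N]card_ord -cardsT; apply: proper_card.
  by apply/properP; split; [exact: finset.subsetT|exists x; rewrite !inE ?ltnn].
have o_inj : injective (fun x => Ordinal (rn x)) by move=> x y [] /rank_inj.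
exists (perm o_inj)^-1%g => a b ab; rewrite ltnNge; apply/negP => /rank_le.
have rE c : rank ((perm o_inj)^-1%g c) = c.
  by have := permKV (perm o_inj) c; rewrite permE => /(congr1 val).
by rewrite !rE leqNgt ab.
Qed.

End SortingPermutation.

Lemma count_codom n (T : eqType) (U : 'I_n -> T) k :
  count_mem k (codom U) = #|[set i | U i == k]|.
Proof.
rewrite codomE count_map -sum1_count big_enum_cond -sum1_card.
by apply: eq_bigl => i; rewrite inE.
Qed.

Lemma decr_uniq n (U V : 'I_n -> nat) : decr U -> decr V ->
  (forall k, #|[set i | U i == k]| = #|[set i | V i == k]|) -> U =1 V.
Proof.
move=> dU dV UV.
have srt (W : 'I_n -> nat) : decr W -> sorted geq (codom W).
  move=> dW; rewrite codomE sorted_map; apply: (@sub_sorted _ (relpre val leq)).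
    by move=> i j /= /dW.
  by rewrite -sorted_map val_enum_ord iota_sorted.
have : codom U = codom V.
  apply: (@sorted_eq _ geq); rewrite ?srt //.
  - by move=> a b c /= ab bc; exact: leq_trans bc ab.
  - by move=> a b; rewrite andbC => /anti_leq.
  by apply/allP => k _ /=; rewrite !count_codom UV.
by rewrite !codomE => /eq_in_map e i; apply: e; rewrite mem_enum.
Qed.

(** * Encoding compatible colored permutations as words in blocks and sections *)

Section Words.
Context {N K n : nat} {S : comNzRingType}.
Variables (t : S) (s : 'I_N.+1 -> S) (U : 'I_n -> 'I_K).
Let V (i : 'I_n) : nat := U i.
Hypothesis dU : decr V.
Implicit Types (p : colperm N.+1 n) (h : {ffun 'I_n -> 'I_K * 'I_N.+2}).

Definition block_first (v : 'I_n) := [forall w : 'I_n, (w < v)%N ==> (U w != U v)].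

(** Words are indexed by values: [x] holds the block of the position of [v] and its section. An
    excedance [v] sits at a position before [v], hence in a block at least [U v], and in [U v]
    itself only if [v] is not its first element. *)
Definition letter_ok (v : 'I_n) (x : 'I_K * 'I_N.+2) :=
  ((x.2 == 0%N :> nat) ==> (U v <= x.1)%N && ~~ ((x.1 == U v) && block_first v))
  && ((x.2 == N.+1 :> nat) ==> (x.1 <= U v)%N).

Definition word_ok h :=
  [forall k, #|[set v | (h v).1 == k]| == #|[set v | U v == k]|]
  && [forall v, letter_ok v (h v)].

(* Section 0 consists of the excedances, section N+1 of the non-excedances of
   color 0. *)
Definition sect_color (b : 'I_N.+2) : 'I_N.+1 :=
  inord (if b == 0%N :> nat then 0%N else (N.+1 - b)%N).

Definition sect_weight (b : 'I_N.+2) : S :=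
  (if b == 0%N :> nat then t else 1) * s (sect_color b).

Definition word_of p : {ffun 'I_n -> 'I_K * 'I_N.+2} :=
  [ffun v => (U (p.1^-1%g v), inord (sect p (p.1^-1%g v)))].

Lemma sect_bound p i : (sect p i < N.+2)%N.
Proof. by rewrite /sect; case: ifP => // _; lia. Qed.

Lemma sect0 p i : (sect p i == 0%N) = (i \in EXC p).
Proof. by rewrite /sect; case: ifP => // _; have := ltn_ord (p.2 i); lia. Qed.

Lemma sect_colorE p i : sect_color (inord (sect p i)) = p.2 i.
Proof.
apply: ord_inj; rewrite /sect_color (inordK (sect_bound p i)) sect0 inordK.
  case: ifP => e; last by rewrite /sect e; have := ltn_ord (p.2 i); lia.
  by move: e; rewrite in_EXC => /andP[/eqP].
by rewrite -sect0; case: eqP; lia.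
Qed.

(** Increasing [key] means decreasing block, then increasing section, then increasing value: the
    order in which a compatible permutation lists its values. *)
Let key h (v : 'I_n) : nat := (((K - (h v).1) * N.+2 + (h v).2) * n + v)%N.

Let ltn_lex (a b c d m : nat) : (b < m)%N -> (d < m)%N ->
  (a * m + b < c * m + d)%N = (a < c)%N || (a == c) && (b < d)%N.
Proof.
move=> bm dm; have [ac|ca|->] := ltngtP a c; last by rewrite ltn_add2l.
  have := leq_mul2r m a.+1 c; rewrite ac orbT mulSn => /idP; lia.
have := leq_mul2r m c.+1 a; rewrite ca orbT mulSn => /idP; lia.
Qed.

Let eqn_lex (a b c d m : nat) : (b < m)%N -> (d < m)%N ->
  (a * m + b == c * m + d)%N = (a == c) && (b == d)%N.
Proof.
move=> bm dm; have := ltn_lex a c bm dm; have := ltn_lex c a dm bm.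
by case: ltngtP; case: ltngtP => //=; lia.
Qed.

Let key_lt h v w : (key h v < key h w)%N =
  ((h w).1 < (h v).1)%N || ((h v).1 == (h w).1) &&
    (((h v).2 < (h w).2)%N || ((h v).2 == (h w).2) && (v < w)%N).
Proof.
rewrite /key ltn_lex // ltn_lex // eqn_lex // -!val_eqE /=.
have := ltn_ord (h v).1; have := ltn_ord (h w).1; lia.
Qed.

Let key_inj h : injective (key h).
Proof.
move=> v w e; have := ltnn (key h v); rewrite {2}e key_lt.
have := ltnn (key h v); rewrite {1}e key_lt -!val_eqE /=.
by move=> *; apply: val_inj => /=; lia.
Qed.

Lemma word_ofE p i : word_of p (p.1 i) = (U i, inord (sect p i)).
Proof. by rewrite ffunE permK. Qed.

Lemma word_of_sorts p : compat V p -> sorts (key (word_of p)) p.1.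
Proof.
move=> /compatP cp a b ab; rewrite key_lt !word_ofE /= !inordK ?sect_bound //.
have := dU (ltnW ab); rewrite /V leq_eqVlt => /orP[/eqP e|->//].
have := cp a b ab (esym e);
  rewrite /sect_lt -!val_eqE /= !inordK ?sect_bound //.
by rewrite e eqxx /= ltnn.
Qed.

Lemma word_of_inj : {in [pred p | compat V p] &, injective word_of}.
Proof.
move=> p q cp cq e.
have e1 : p.1 = q.1.
  apply: (sorts_uniq (@key_inj (word_of p))); first exact: word_of_sorts.
  by rewrite e; exact: word_of_sorts.
rewrite [p]surjective_pairing [q]surjective_pairing e1; congr pair.
apply/ffunP => i; rewrite -!sect_colorE; congr sect_color.
have := word_ofE p i; rewrite e e1 word_ofE => -[/(congr1 val)].
by rewrite /= !inordK ?sect_bound // => ->.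
Qed.

Lemma word_of_ok p : compat V p -> word_ok (word_of p).
Proof.
move=> cp; apply/andP; split; apply/forallP.
  move=> k; rewrite -(card_preimset [set v | U v == k] (@perm_inj _ p.1^-1%g)).
  by apply/eqP; apply: eq_card => v; rewrite !inE ffunE.
move=> v; have [i ->] : exists i, v = p.1 i by exists (p.1^-1%g v);
  rewrite permKV.
rewrite word_ofE /letter_ok /= !inordK ?sect_bound // sect0.
apply/andP; split; apply/implyP.
  move=> iE; have iv : (i < p.1 i)%N by move: iE; rewrite in_EXC => /andP[].
  rewrite (dU (ltnW iv)) /=; apply/negP => /andP[/eqP e /forallP/(_ i)].
  by rewrite iv e eqxx.
move=> /eqP sE; apply: dU; rewrite leqNgt; apply/negP => iv; move: sE.
rewrite /sect in_EXC iv andbT; case: eqP => // /eqP c0.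
by have := ltn_ord (p.2 i); lia.
Qed.

(** The preimage is the permutation that sorts [key h]. The local conditions compare blocks only;
    sortedness within a block turns them into inequalities between positions and values. *)
Lemma word_of_surj h : word_ok h -> exists2 p, compat V p & word_of p = h.
Proof.
case/andP => /forallP hU /forallP hok.
have [w sw] := sorts_exists (@key_inj h).
(* The blocks read along [w] decrease and have the same content as [U], hence agree with [U]. *)
have hwU a : (h (w a)).1 = U a.
  apply: val_inj; rewrite /=.
  apply: (@decr_uniq n (fun a => (h (w a)).1) V) => // [a' b|k].
    rewrite leq_eqVlt => /orP[/eqP/val_inj->//|/sw]; rewrite key_lt -val_eqE /=.
    by lia.
  have [kK|kK] := ltnP k K; last first.
    have e0 (F : 'I_n -> 'I_K) : #|[set i | F i == k :> nat]| = 0%N.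
      apply: eq_card0 => i; rewrite inE; apply/eqP => e.
      by move: kK; rewrite -e leqNgt ltn_ord.
    exact: etrans (e0 _) (esym (e0 _)).
  have := eqP (hU (Ordinal kK)); rewrite -(card_preimset _ (@perm_inj _ w)).
  move=> e; transitivity #|w @^-1: [set v | (h v).1 == Ordinal kK]|.
    by apply: eq_card => i; rewrite !inE.
  by rewrite e; apply: eq_card => i; rewrite !inE.
have {}hok a : letter_ok (w a) (U a, (h (w a)).2).
  by rewrite -(hwU a) -surjective_pairing; exact: hok.
have ws (a b : 'I_n) : (a < b)%N -> U a = U b -> ((h (w a)).2 < (h (w b)).2)%N
    || ((h (w a)).2 == (h (w b)).2) && (w a < w b)%N.
  by move=> /sw; rewrite key_lt !hwU => + e; rewrite e ltnn eqxx.
(* Induction from the left end of the block. At its first position [letter_ok] and [dU] exclude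
   [w a <= a]; later on, the preceding letter is also in section 0 and has a smaller value. *)
have up a : (h (w a)).2 = 0%N :> nat -> (a < w a)%N.
  have [m mE] := ubnP a; elim: m a mE => // m IHm a mE b0.
  have := hok a; rewrite /letter_ok /= b0 /= => /andP[/andP[Uwa fa] _].
  case: (boolP (block_first a)) => [fsta|].
    rewrite ltnNge; apply/negP; rewrite leq_eqVlt => /orP[/eqP e|wa].
      by move: fa; rewrite (val_inj e : w a = a) eqxx fsta.
    have /forallP/(_ (w a)) := fsta; rewrite wa -val_eqE /= => ne.
    by have := dU (ltnW wa); rewrite /V; lia.
  rewrite /block_first => /forallPn[c];
    rewrite negb_imply negbK => /andP[ca /eqP Uc].
  have a1n : (a.-1 < n)%N by have := ltn_ord a; lia.
  have U1 : U (Ordinal a1n) = U a.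
    apply/val_inj/eqP; rewrite eqn_leq -{1}Uc; apply/andP; split;
      apply: dU => /=; lia.
  have := ws (Ordinal a1n) a _ U1; rewrite b0 ltn0 -val_eqE /= b0.
  have := IHm (Ordinal a1n); rewrite /=; lia.
(* Induction from the right: if [a < w a], then [a+1] is in the block of [a], its letter is also in
   the last section, and its value, larger than [w a], is at most [a+1]. *)
have down a : (h (w a)).2 = N.+1 :> nat -> (w a <= a)%N.
  have [m mE] := ubnP (n - a); elim: m a mE => // m IHm a mE b1.
  have := hok a; rewrite /letter_ok /= b1 eqxx /= => Uwa.
  rewrite leqNgt; apply/negP => wa.
  have U1 : U (w a) = U a.
    by apply/val_inj/eqP; rewrite eqn_leq Uwa andbT; exact: (dU (ltnW wa)).
  have a1n : (a.+1 < n)%N by have := ltn_ord (w a); lia.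
  have U2 : U a = U (Ordinal a1n).
    apply/val_inj/eqP; rewrite eqn_leq -{1}U1; apply/andP; split;
      apply: dU => /=; lia.
  have := ws a (Ordinal a1n) (ltnSn _) U2;
    have := ltn_ord (h (w (Ordinal a1n))).2.
  have := IHm (Ordinal a1n); rewrite -val_eqE /= b1; lia.
pose p : colperm N.+1 n := (w, [ffun a => sect_color (h (w a)).2]).
have sE a : sect p a = (h (w a)).2.
  rewrite /sect in_EXC /= ffunE /sect_color inordK; last by case: eqP; lia.
  have [e|/negPf ne] := eqVneq ((h (w a)).2 : nat) 0%N.
    by rewrite e eqxx up.
  by move: ne; have := down a; have := ltn_ord (h (w a)).2; case: ifP; lia.
exists p.
  apply/compatP => a b ab /val_inj e; have := ws a b ab e.
  by rewrite /sect_lt !sE -val_eqE.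
apply/ffunP => v; rewrite ffunE sE inord_val -hwU permKV.
by rewrite -surjective_pairing.
Qed.

Lemma compat_sum_words :
  compat_sum t s (fun _ _ => 1) V =
  \sum_(h | word_ok h) \prod_v sect_weight (h v).2.
Proof.
transitivity (\sum_(h in word_of @: [set p | compat V p])
    \prod_v sect_weight (h v).2); last first.
  apply: eq_bigl => h; apply/imsetP/idP => [[p]|/word_of_surj[p cp <-]].
    by rewrite inE => cp ->; exact: word_of_ok.
  by exists p; rewrite ?inE.
rewrite big_imset /=; last first.
  by move=> p q; rewrite !inE => cp cq; apply: word_of_inj; rewrite inE.
rewrite /compat_sum; apply: eq_big => [p|p _]; first by rewrite inE.
rewrite [RHS](reindex_inj (@perm_inj _ p.1)) /=; apply: eq_bigr => i _.
rewrite word_ofE /sect_weight sect_colorE inordK ?sect_bound // sect0.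
by rewrite if_same mulr1.
Qed.

End Words.

(** * Extracting coefficients of products of linear forms *)

Section Monomials.
Context {V : choiceType}.
Implicit Types m : {cmonom V}.

Lemma cm_prodE (I : Type) (l : seq I) (P : pred I) (F : I -> {cmonom V}) k :
  (\big[mmul/1%M]_(i <- l | P i) F i) k = (\sum_(i <- l | P i) F i k)%N.
Proof. by apply: (big_morph (fun m : {cmonom V} => m k)) => [a b|];
  rewrite ?cmM ?cm1. Qed.

Lemma cm_prodU (I : finType) (F : I -> V) k :
  (\big[mmul/1%M]_i U_(F i)%M) k = #|[set i | F i == k]|.
Proof.
rewrite cm_prodE -sum1_card [RHS]big_mkcond /=.
by apply: eq_bigr => i _; rewrite cmU inE; case: eqP.
Qed.

Lemma cm_split m k : m k != 0%N -> exists m', m = (U_(k) * m')%M.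
Proof.
move=> mk; exists (divcm m U_(k)%M); apply/eqP/cmP => i; rewrite cmM divcmE cmU.
by case: eqP => [<-|]; lia.
Qed.

Context {S : comNzRingType}.
Implicit Types f g : mps V S.

Lemma mcoefXM k f m : mcoef (mpsX k * f) (U_(k) * m)%M = mcoef f m.
Proof.
rewrite mcoefM (fsbigE [:: (U_(k)%M, m)]) //=.
- by rewrite big_cons big_nil ifT ?addr0 ?mpsXE ?mcoef_mpsM ?eqxx ?mul1r ?mem_set.
- by move=> p /=; rewrite inE => /eqP ->.
move=> [a b] /= ab; rewrite inE mpsXE mcoef_mpsM.
case: (eqVneq a U_(k)%M) => [ea|]; last by rewrite mul0r.
rewrite ea xpair_eqE eqxx /= => /eqP[]; apply/eqP/cmP => i.
by have := congr1 (fun m : {cmonom V} => m i) ab; rewrite ea /= !cmM => /addnI.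
Qed.

Lemma mcoefXM0 k f m : m k = 0%N -> mcoef (mpsX k * f) m = 0.
Proof.
move=> mk; rewrite mcoefM; apply: fsbig1 => -[a b] /= ab.
rewrite mpsXE mcoef_mpsM /=; case: (eqVneq a U_(k)%M) => [ea|];
  last by rewrite mul0r.
by move: mk; rewrite -ab ea /= cmM cmUU.
Qed.

Lemma mcoef_1BXM c k f m : mcoef ((1 - c *: mpsX k) * f) m =
  mcoef f m - c * mcoef (mpsX k * f) m.
Proof. by rewrite mulrBl mul1r mcoefB -scalerAl mcoefZ. Qed.

(* Congruence modulo the variables that do not occur in [m]. *)
Definition eq_supp m f g :=
  forall a : {cmonom V}, (forall k, m k = 0%N -> a k = 0%N) ->
    mcoef f a = mcoef g a.

Lemma eq_suppM m f g f' g' : eq_supp m f f' -> eq_supp m g g' ->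
  eq_supp m (f * g) (f' * g').
Proof.
move=> ff' gg' a am; rewrite !mcoefM; apply: eq_fsbigr => -[b c];
  rewrite inE => /= bc.
by rewrite ff' ?gg' // => k /am; rewrite -bc /= cmM; lia.
Qed.

Lemma eq_suppD m f g f' g' : eq_supp m f f' -> eq_supp m g g' ->
  eq_supp m (f + g) (f' + g').
Proof. by move=> ff' gg' a am; rewrite !mcoefD ff' ?gg'. Qed.

Lemma eq_suppZ m c f f' : eq_supp m f f' -> eq_supp m (c *: f) (c *: f').
Proof. by move=> ff' a am; rewrite !mcoefZ ff'. Qed.

Lemma eq_suppX m e f f' : eq_supp m f f' -> eq_supp m (f ^+ e) (f' ^+ e).
Proof. by move=> ff'; elim: e => // e IHe; rewrite !exprS; apply: eq_suppM. Qed.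

End Monomials.

(** [Q] changes only across elements of [P], so [Q k.+1] at one element of [P] is [Q] at the next
    one, and [D] collects these common factors. An element of [P] is needed for the end factors to
    occur. *)
Lemma telescope_prod (R : comNzRingType) (P : pred nat) (Q : nat -> R) n :
  (forall k, ~~ P k -> Q k.+1 = Q k) ->
  (exists2 k, (k < n)%N & P k) ->
  exists D, \prod_(0 <= k < n | P k) Q k = Q 0%N * D /\
            \prod_(0 <= k < n | P k) Q k.+1 = D * Q n.
Proof.
move=> QP; elim: n => [[]//|n IHn] [k kn Pk].
have recr F : \prod_(0 <= k < n.+1 | P k) F k =
    \prod_(0 <= k < n | P k) F k * (if P n then F n else 1 : R).
  by rewrite big_mkcond big_nat_recr //= -big_mkcond.
rewrite !recr.
case: (boolP [exists i : 'I_n, P i]) => [/existsP[i Pi]|nP].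
  have [D [-> ->]] : exists D, \prod_(0 <= k < n | P k) Q k = Q 0%N * D /\
      \prod_(0 <= k < n | P k) Q k.+1 = D * Q n.
    by apply: IHn; exists i.
  case: ifP => [_|/negbT/QP ->]; last by exists D; rewrite !mulr1.
  by exists (D * Q n); rewrite !mulrA.
have nPi i : (i < n)%N -> ~~ P i.
  by move=> i_n; apply: contra nP => Pi; apply/existsP; exists (Ordinal i_n).
have -> : P n.
  by have [e|ne] := eqVneq k n; [rewrite -e|have := nPi k; rewrite Pk; lia].
have Qn : Q n = Q 0%N.
  elim: n nPi {IHn kn nP recr} => // n IHn nPi.
  by rewrite QP ?IHn ?nPi // => i i_n; apply: nPi; lia.
(* Here [n] is the only element of [P] up to [n], so there are no inner factors. *)
exists 1; rewrite mulr1 mul1r Qn !big1_seq ?mul1r // => i /andP[Pi];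
by rewrite mem_index_iota => /nPi; rewrite Pi.
Qed.

(** * Products of block weights and their telescoping *)

Section Blocks.
Context {K : nat} {S : comNzRingType}.
Variables (z t al be : S).
Hypothesis albe : al - be = 1 - t.
Implicit Types (m : {cmonom 'I_K}) (y : 'I_K -> mps 'I_K S).

(** This is Q_j, and [letters y k] below is Q_k + y_k. *)
Definition cutsum y (j : nat) : mps 'I_K S :=
  \sum_(i < K) (if (i < j)%N then al else be) *: y i.

Definition letters y (k : 'I_K) := cutsum y k + y k.

Lemma cutsumS y (k : 'I_K) : cutsum y k.+1 = cutsum y k + (1 - t) *: y k.
Proof.
rewrite /cutsum (bigD1 k) //= [in RHS](bigD1 k) //= ltnSn ltnn -addrA
  [X in _ = _ + X]addrC addrA -scalerDl.
rewrite -albe addrCA subrr addr0; congr (_ + _); apply: eq_bigr => i ik.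
by rewrite ltnS leq_eqVlt val_eqE (negPf ik).
Qed.

Lemma lettersB y k : letters y k - t *: y k = cutsum y k.+1.
Proof. by rewrite cutsumS scalerBl scale1r addrA. Qed.

(** The weight of the [e] elements of block [k], of which only the first is modified: its factor is
    Q_k for [a = 1] and Q_(k+1) for [a = t]. *)
Definition block y a (k : 'I_K) (e : nat) : mps 'I_K S :=
  if e is e'.+1 then (letters y k - a *: y k) * letters y k ^+ e' else 1.

(** Both products have the same inner factors; there remain Q_0 = be sum y on the left and Q_K = al
    sum y on the right. Since [y] vanishes on empty blocks, Q_k changes only across blocks that
    occur. *)
Lemma block_telescope m y : m != 1%M -> (forall k, m k = 0%N -> y k = 0) ->
  al *: \prod_k block y 1 k (m k) = be *: \prod_k block y t k (m k).
Proof.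
move=> m1 ym; pose P i := [exists k : 'I_K, (k == i :> nat) && (m k != 0%N)].
have PE (k : 'I_K) : P k = (m k != 0%N).
  apply/existsP/idP => [[l /andP[/eqP/val_inj->]]//|mk].
  by exists k; rewrite eqxx.
have blockE a : \prod_k block y a k (m k) =
    (\prod_(k < K | P k) (letters y k - a *: y k)) *
      \prod_(k < K | P k) letters y k ^+ (m k).-1.
  rewrite -big_split [RHS]big_mkcond /=; apply: eq_bigr => k _.
  by rewrite PE /block; case: (m k).
have [||D [D1 D2]] := @telescope_prod _ P (cutsum y) K.
- move=> k nP; have [kK|kK] := ltnP k K; last first.
    by apply: eq_bigr => i _; rewrite !ifT //; have := ltn_ord i; lia.
  rewrite (cutsumS y (Ordinal kK)) ym ?scaler0 ?addr0 //.
  by have := PE (Ordinal kK); rewrite (negPf nP) => /esym/negbFE/eqP.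
- have [k mk] : exists k, m k != 0%N.
    apply/not_existsP => mk; case/eqP: m1; apply/eqP/cmP => k; rewrite cm1.
    by apply/eqP/negbNE/negP/mk.
  by exists (k : nat); rewrite ?PE.
rewrite !big_mkord in D1 D2.
rewrite !blockE.
have -> : \prod_(k < K | P k) (letters y k - 1 *: y k) = cutsum y 0 * D.
  by rewrite -D1; apply: eq_bigr => k _; rewrite scale1r addrK.
have -> : \prod_(k < K | P k) (letters y k - t *: y k) = D * cutsum y K.
  by rewrite -D2; apply: eq_bigr => k _; rewrite lettersB.
have -> : cutsum y 0 = be *: \sum_i y i.
  by rewrite scaler_sumr; apply: eq_bigr.
have -> : cutsum y K = al *: \sum_i y i.
  by rewrite scaler_sumr; apply: eq_bigr => i _; rewrite ltn_ord.
rewrite -!scalerAl -scalerAr -scalerAl !scalerA mulrC; congr (_ *: (_ * _)).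
by rewrite mulrC.
Qed.

(** A diagonal extraction as in MacMahon's master theorem: the product itself depends on [m], which
    prescribes how often each linear form is used. *)
Definition block_series a : mps 'I_K S :=
  MPS (fun m => z ^+ mdeg m * mcoef (\prod_k block (@mpsX _ S) a k (m k)) m).

Definition letters_series : mps 'I_K S :=
  MPS (fun m => z ^+ mdeg m * mcoef (\prod_k letters (@mpsX _ S) k ^+ m k) m).

(** The coefficient of [m'] in f is that of [U_(k) * m'] in x_k f. Hence multiplication by 1 - a z
    x_k turns one factor of block k into [letters k - a x_k] wherever that block occurs. The list
    [L] holds the blocks already treated. *)
Lemma block_series_prod a :
  block_series a = \prod_k (1 - (a * z) *: mpsX k) * letters_series.
Proof.
pose F (L : seq 'I_K) m k :=
  if k \in L then block (@mpsX _ S) a k (m k) else letters (@mpsX _ S) k ^+ m k.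
suff FE L : uniq L ->
    MPS (fun m => z ^+ mdeg m * mcoef (\prod_k F L m k) m) =
    \prod_(k <- L) (1 - (a * z) *: mpsX k) * letters_series.
  rewrite -FE ?index_enum_uniq //; apply: mpsP => m /=.
  by congr (_ * mcoef _ _); apply: eq_bigr => k _; rewrite /F mem_index_enum.
elim: L => [_|k L IHL /= /andP[kL uL]].
  rewrite big_nil mul1r; apply: mpsP => m /=.
  by congr (_ * mcoef _ _); apply: eq_bigr => k _; rewrite /F.
rewrite big_cons -mulrA -{}IHL //; apply: mpsP => m /=.
have split_k A m' : \prod_j F A m' j = F A m' k * \prod_(j | j != k) F A m' j.
  by rewrite (bigD1 k).
rewrite mcoef_1BXM /= (split_k (k :: L)) (split_k L).
have Fk e : F (k :: L) e k = block (@mpsX _ S) a k (e k).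
  by rewrite /F mem_head.
have FL e : F L e k = letters (@mpsX _ S) k ^+ e k by rewrite /F (negPf kL).
rewrite Fk FL; have [mk|/cm_split[m' ->]] := eqVneq (m k) 0%N.
  rewrite mcoefXM0 // mulr0 subr0 mk expr0 /=; congr (_ * mcoef (_ * _) _).
  by apply: eq_bigr => j /negPf jk; rewrite /F inE jk.
rewrite mcoefXM /= (split_k L) FL cmM cmUU add1n mdegM mdegU /=.
rewrite (eq_bigr (F L m')) => [|j jk]; last first.
  by rewrite /F inE (negPf jk) /= cmM cmU eq_sym (negPf jk).
rewrite [X in _ = _ * mcoef (_ * X) _ - _](eq_bigr (F L m')) => [|j jk];
  last first.
  by rewrite /F cmM cmU eq_sym (negPf jk).
rewrite exprS mulrBl -exprS mulrBl -!scalerAl -mulrA mcoefB mcoefZ mcoefXM.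
rewrite mulrBr addnC addn1 exprS; congr (_ - _).
by rewrite [a * z]mulrC -!mulrA; congr (_ * _); exact: mulrCA.
Qed.

(** The telescoping cancels all coefficients except the constant one, which is [al - be]. *)
Lemma letters_seriesE :
  (al *: \prod_k (1 - z *: mpsX k) - be *: \prod_k (1 - (t * z) *: mpsX k))
    * letters_series = (1 - t)%:A.
Proof.
rewrite mulrBl -!scalerAl.
have /(_ 1) := block_series_prod; rewrite mul1r => <-.
rewrite -block_series_prod; apply: mpsP => m.
rewrite mcoefB !mcoefZ /= mcoef1 -albe.
have [->|m1] := eqVneq m 1%M.
  rewrite mdeg1 expr0 !mul1r !big1 => [|k _|k _]; rewrite ?cm1 //.
  by rewrite !mcoef1 eqxx !mulr1.
(* Variables outside the support of [m] do not affect this coefficient; setting them to 0 lets the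
   telescoping pass over empty blocks. *)
pose y k : mps 'I_K S := if m k == 0%N then 0 else mpsX k.
have bE a : mcoef (\prod_k block (@mpsX _ S) a k (m k)) m
          = mcoef (\prod_k block y a k (m k)) m.
  suff: eq_supp m (\prod_k block (@mpsX _ S) a k (m k)) (\prod_k block y a k (m k)).
    by apply.
  have yE k : eq_supp m (mpsX k) (y k).
    move=> e em; rewrite /y; case: eqP => // /em ek.
    by rewrite -[mpsX k]mulr1 mcoefXM0.
  have lE k : eq_supp m (letters (@mpsX _ S) k) (letters y k).
    apply: eq_suppD => //; apply: (big_ind2 (eq_supp m)) => //.
      by move=> *; apply: eq_suppD.
    by move=> i _; exact: eq_suppZ.
  apply: (big_ind2 (eq_supp m)) => // [*|k _]; first exact: eq_suppM.
  rewrite /block; case: (m k) => // e; apply: eq_suppM; last exact: eq_suppX.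
  by rewrite -!scaleNr; apply: eq_suppD => //; apply: eq_suppZ.
have ym k : m k = 0%N -> y k = 0 by move=> mk; rewrite /y mk.
have /(congr1 (fun f => mcoef f m)) := block_telescope m1 ym.
rewrite !mcoefZ -!bE mulr0 !(mulrCA _ (z ^+ _)) => ->.
by rewrite subrr.
Qed.

End Blocks.

(** * The generating series of the compatible permutations *)

Lemma mdeg_ord K (m : {cmonom 'I_K}) : mdeg m = (\sum_k m k)%N.
Proof.
rewrite mdegE big_uniq ?fset_uniq // big_mkcond; apply: eq_bigr => k _.
by rewrite -cmE_neq0; case: eqP => [->|].
Qed.

Definition content K n (m : {cmonom 'I_K}) (U : 'I_n -> 'I_K) :=
  forall k, #|[set i | U i == k]| = m k.

Lemma block_word_subproof K (m : {cmonom 'I_K}) :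
  exists U : 'I_(mdeg m) -> 'I_K, decr (fun i => U i : nat) /\ content m U.
Proof.
pose l := sort (fun a b : 'I_K => (b <= a)%N)
  (flatten [seq nseq (m k) k | k <- enum 'I_K]).
have sl : size l == mdeg m.
  rewrite size_sort size_flatten /shape -map_comp sumnE big_map big_enum mdeg_ord.
  by apply/eqP/eq_bigr => k _; rewrite /= size_nseq.
exists (tnth (Tuple sl)); split=> [i j|k].
  rewrite leq_eqVlt => /orP[/eqP/val_inj ->//|ij].
  have trl : transitive (fun a b : 'I_K => (b <= a)%N).
    by move=> a b c ba cb; exact: leq_trans cb ba.
  have srt : sorted (fun a b : 'I_K => (b <= a)%N) l
    by apply: sort_sorted => a b; exact: leq_total.
  have x0 : 'I_K := tnth (Tuple sl) i.
  rewrite !(tnth_nth x0) /=.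
  by apply: (sorted_ltn_nth trl) => //; rewrite inE (eqP sl).
rewrite -count_codom codomE map_tnth_enum /=.
rewrite (seq.permP (permEl (perm_sort _ _))) count_flatten -map_comp
  sumnE big_map big_enum /=.
rewrite (bigD1 k) //= count_nseq /= eqxx mul1n big1 ?addn0 // => j jk.
by rewrite count_nseq /= (negPf jk).
Qed.

Definition block_word K (m : {cmonom 'I_K}) : 'I_(mdeg m) -> nat :=
  fun i => sval (cid (block_word_subproof m)) i.
Arguments block_word {K} m i.

Section WordSeries.
Context {N K : nat} {S : comNzRingType}.
Variables (z t : S) (s : 'I_N -> S).
Implicit Types (m : {cmonom 'I_K}) (r : nat -> 'I_N -> S).

(** A decreasing word is determined by its content, so any convenient [U] may replace
    [block_word m]; the free length [n] admits words on ['I_(mdeg m').+1]. *)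
Lemma compat_sum_block_word n m r (U : 'I_n -> 'I_K) :
  decr (fun i => U i : nat) -> content m U ->
  mdeg m = n /\
  compat_sum t s r (block_word m) = compat_sum t s r (fun i => U i : nat).
Proof.
move=> dU cU; have e : mdeg m = n.
  rewrite mdeg_ord -[RHS]card_ord -sum1_card (partition_big U predT) //=.
  apply: eq_bigr => k _; rewrite -cU -sum1_card.
  by apply: eq_bigl => i; rewrite inE.
split=> //; case: _ / e in U dU cU *; congr compat_sum; apply/funext.
rewrite /block_word; case: cid => V [dV cV] /=; apply: decr_uniq => // k.
have [kK|kK] := ltnP k K.
  have cE (W : 'I_(mdeg m) -> 'I_K) :
      #|[set i | W i == k :> nat]| = #|[set i | W i == Ordinal kK]|.
    by apply: eq_card => i; rewrite !inE.
  by rewrite !cE cU cV.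
have c0 (W : 'I_(mdeg m) -> 'I_K) : #|[set i | W i == k :> nat]| = 0%N.
  apply: eq_card0 => i; rewrite inE; apply/eqP => e.
  by move: kK; rewrite -e leqNgt ltn_ord.
by rewrite !c0.
Qed.

Definition word_series r : mps 'I_K S :=
  MPS (fun m => z ^+ mdeg m * compat_sum t s r (block_word m)).

Lemma eq_word_series r r' : (forall (k : 'I_K) c, r k c = r' k c) ->
  word_series r = word_series r'.
Proof.
move=> rr'; apply: mpsP => m /=; congr (_ * _); apply: eq_bigr => p _.
by apply: eq_bigr => i _; rewrite /block_word rr'.
Qed.

(** The two deletions differ only between [i] and [k], where [U] is constant. *)
Lemma lift_block n (U : 'I_n.+1 -> nat) i k : decr U -> U i = U k ->
  forall j : 'I_n, U (lift i j) = U (lift k j).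
Proof.
move=> dU; wlog ik : i k / (i <= k)%N.
  move=> H e j; have [ik|/ltnW ki] := leqP i k; first exact: H.
  by apply/esym/H.
move=> e j; have [jlt|jge] := ltnP j i.
  by congr U; apply: ord_inj; rewrite /= /bump; lia.
have [kj|jk] := leqP k j.
  by congr U; apply: ord_inj; rewrite /= /bump; lia.
have Uk (l : 'I_n.+1) : (i <= l <= k)%N -> U l = U i.
  by case/andP=> il lk; apply/eqP; rewrite eqn_leq dU // e dU.
by rewrite !Uk // /= /bump; lia.
Qed.

(** This is [compat_sum_unfix] read coefficientwise: the factor [mpsX k] accounts for the removed
    position of block [k]. *)
Lemma word_series_unfix r (k : 'I_K) c :
  word_series (unfix r k c) = (1 - (s c * r k c * z) *: mpsX k) * word_series r.
Proof.
apply: mpsP => m; rewrite mcoef_1BXM.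
have [mk|mk] := eqVneq (m k) 0%N.
  rewrite mcoefXM0 // mulr0 subr0 /=; congr (_ * _); apply: compat_sum_nofix.
  move=> i; rewrite /block_word; case: cid => U [dU cU] /=.
  apply/negP => /eqP/val_inj e;
    have : i \in [set i | U i == k] by rewrite inE e.
  by rewrite (cards0_eq (etrans (cU k) mk)) inE.
have [m' mE] := cm_split mk; rewrite mE mcoefXM /= -mE.
have [U [dU cU]] : exists U : 'I_(mdeg m').+1 -> 'I_K,
    decr (fun i => U i : nat) /\ content m U.
  by have := block_word_subproof m; rewrite mE mdegM mdegU add1n.
have [dm cm] := compat_sum_block_word r dU cU.
have [_ ->] := compat_sum_block_word (unfix r k c) dU cU; rewrite cm dm.
have [i0 Ui0] : exists i, U i = k.
  have /card_gt0P[i] : (0 < #|[set i | U i == k]|)%N by rewrite cU lt0n.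
  by rewrite inE => /eqP; exists i.
pose U' j := U (lift i0 j).
have dU' : decr (fun j => U' j : nat).
  by move=> i j ij; apply: dU; rewrite /= leq_bump2.
have cU' : content m' U'.
  have cardE n (W : 'I_n -> 'I_K) l : #|[set i | W i == l]| = (\sum_i (W i == l))%N.
    by rewrite -sum1_card big_mkcond; apply: eq_bigr => i _; rewrite inE;
      case: eqP.
  move=> l; have := cU l; rewrite !cardE mE cmM cmU (bigD1_ord i0) //= Ui0.
  exact: addnI.
have [_ ->] := compat_sum_block_word r dU' cU'.
rewrite (compat_sum_unfix (U' := fun j => U' j : nat) (kap := k) t s r c) //.
- rewrite exprS; set A := compat_sum _ _ _ _; set B := compat_sum _ _ _ _.
  by move: (z ^+ _) A B (s c) (r _ c) => Z A B sc rc; ring.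
- move=> i Ui j; apply: (lift_block (U := fun i => U i : nat)) => //.
  by rewrite Ui Ui0.
- by exists i0; rewrite Ui0.
Qed.

(** Fixed points are switched off one block and one color at a time; [L] lists the pairs already
    treated. *)
Lemma word_series_fix r :
  \prod_(k < K) \prod_c (1 - (s c * r k c * z) *: mpsX k) * word_series r
  = word_series (fun _ _ => 0).
Proof.
pose w (x : 'I_K * 'I_N) : mps 'I_K S := 1 - (s x.2 * r x.1 x.2 * z) *: mpsX x.1.
pose r0 (L : seq ('I_K * 'I_N)) k c : S :=
  if has (fun x : 'I_K * 'I_N => (k == x.1 :> nat) && (c == x.2)) L
    then 0 else r k c.
suff HL L : uniq L -> \prod_(x <- L) w x * word_series r = word_series (r0 L).
  rewrite pair_big /= (HL _ (index_enum_uniq _)); apply: eq_word_series => k c.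
  by rewrite /r0 ifT //; apply/hasP; exists (k, c);
    rewrite ?mem_index_enum //= !eqxx.
elim: L => [_|x L IHL /= /andP[xL uL]]; first by rewrite big_nil mul1r.
rewrite big_cons -mulrA IHL // /w.
have <- : r0 L x.1 x.2 = r x.1 x.2.
  rewrite /r0 ifN //; apply/hasPn => -[k c] yL; apply: contra xL.
  by move=> /andP[/eqP/val_inj/= e1 /eqP/= e2];
    rewrite [x]surjective_pairing e1 e2.
by rewrite -word_series_unfix; apply: eq_word_series => k c;
  rewrite /unfix /r0 /=; case: ifP.
Qed.

End WordSeries.

(** * Evaluation of the word series *)

Section WordSeriesWithoutFixedPoints.
Context {N K : nat} {S : comNzRingType}.
Variables (z t : S) (s : 'I_N.+1 -> S).
Hypothesis s0 : s ord0 = 1.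
Let sg := \sum_(c < N) s (lift ord0 c).
Local Notation X := (@mpsX 'I_K S).
Local Notation al := (1 + sg).
Local Notation be := (t + sg).

Lemma mcoef_prod_letters (J : finType) n (b : 'I_n -> J -> S) (l : J -> 'I_K)
    (m : {cmonom 'I_K}) :
  mcoef (\prod_v \sum_x b v x *: mpsX (l x)) m =
  \sum_(h : {ffun 'I_n -> J})
    if [forall k, #|[set v | l (h v) == k]| == m k] then \prod_v b v (h v) else 0.
Proof.
rewrite bigA_distr_bigA mcoef_sum; apply: eq_bigr => h _.
rewrite scaler_prod mcoefZ [X in mcoef X](eq_bigr (fun v => mpsM U_(l (h v))%M));
  last by move=> v _; rewrite mpsXE.
rewrite -mpsM_prod mcoef_mpsM.
have -> : (m == \big[mmul/1%M]_(i < n) U_(l (h i))%M) =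
    [forall k, #|[set v | l (h v) == k]| == m k].
  apply/cmP/forallP => H k; first by rewrite H cm_prodU.
  by rewrite cm_prodU -(eqP (H k)).
by case: ifP => _; rewrite ?mulr1 ?mulr0.
Qed.

Lemma sect_weight_sum (P0 P1 : bool) :
  \sum_(b : 'I_N.+2) (if ((b == 0%N :> nat) ==> P0) && ((b == N.+1 :> nat) ==> P1)
                      then sect_weight t s b else 0)
  = (if P0 then t else 0) + sg + (if P1 then 1 else 0).
Proof.
rewrite big_ord_recl big_ord_recr /= andbT eqxx /= addrA; congr (_ + _ + _).
- case: P0 => //; rewrite /sect_weight /= /sect_color /=.
  by rewrite (_ : inord 0 = ord0) ?s0 ?mulr1 //; apply: ord_inj; rewrite inordK.
- rewrite /sg (reindex_inj rev_ord_inj) /=; apply: eq_bigr => b _.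
  rewrite /bump /= ifT; last by have := ltn_ord b; lia.
  rewrite /sect_weight /= mul1r; congr s; apply: ord_inj.
  by rewrite /sect_color /= inordK /bump /=; have := ltn_ord b; lia.
case: P1 => //; rewrite /sect_weight /= mul1r.
rewrite (_ : sect_color _ = ord0) //; apply: ord_inj.
by rewrite /sect_color /= inordK /bump /=; lia.
Qed.

(** Blocks below [U v] admit no excedance and contribute [al]; blocks above admit no non-excedance
    of color 0 and contribute [be]. Block [U v] contributes [al] if [v] is its first element, and
    [al + t] otherwise. *)
Lemma letter_sum n (U : 'I_n -> 'I_K) v :
  \sum_(x : 'I_K * 'I_N.+2)
     (if letter_ok U v x then sect_weight t s x.2 else 0) *: mpsX x.1 =
  if block_first U v then cutsum al be X (U v).+1 else letters al be X (U v).
Proof.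
transitivity (\sum_(k < K)
  ((if (U v <= k)%N && ~~ ((k == U v) && block_first U v) then t else 0)
    + sg + (if (k <= U v)%N then 1 else 0)) *: mpsX k).
  rewrite -(pair_bigA _ (fun k b => (if letter_ok U v (k, b) then sect_weight t s b
    else 0) *: mpsX k)) /=; apply: eq_bigr => k _.
  by rewrite -scaler_suml /letter_ok /= sect_weight_sum.
case: ifP => fv.
  apply: eq_bigr => k _; congr (_ *: _).
  by rewrite andbT ltnS -val_eqE /=; case: ltngtP => _ /=; ring.
transitivity (\sum_(k < K)
  ((if (k < U v)%N then al else be) + (k == U v)%:R) *: X k).
  apply: eq_bigr => k _; congr (_ *: _).
  by rewrite andbF andbT -val_eqE /=; case: ltngtP => _ /=; ring.
rewrite /letters /cutsum; under eq_bigr do rewrite scalerDl.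
rewrite big_split /=; congr (_ + _); rewrite (bigD1 (U v)) //= eqxx scale1r.
by rewrite big1 ?addr0 // => k /negPf ->; rewrite scale0r.
Qed.

Lemma prod_blocks n (U : 'I_n -> 'I_K) m : content m U ->
  \prod_v (if block_first U v
    then cutsum al be X (U v).+1 else letters al be X (U v))
  = \prod_k block al be X t k (m k).
Proof.
move=> cU; rewrite (partition_big U predT) //=; apply: eq_bigr => k _.
rewrite -cU; case: (posnP #|[set v | U v == k]|) => [c0|/card_gt0P[v1]].
  rewrite c0 big_pred0 // => v; have := cards0_eq c0 => /setP/(_ v).
  by rewrite !inE.
rewrite inE => Uv1.
have [v0 Uv0 min_v0] := @arg_minnP _ v1 (fun v => U v == k) val Uv1.
have first v : U v == k -> block_first U v = (v == v0).
  move=> Uv; apply/forallP/eqP => [H|-> w].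
    apply/ord_inj/eqP; rewrite eqn_leq [X in _ && X]min_v0 // andbT leqNgt.
    by apply/negP => v0v; have := H v0; rewrite v0v (eqP Uv0) (eqP Uv) eqxx.
  apply/implyP => wv0; apply/negP; rewrite (eqP Uv0) => /min_v0; rewrite leqNgt.
  by rewrite /= wv0.
rewrite (bigD1 v0) //= first // eqxx (cardsD1 v0) inE Uv0 add1n /=.
rewrite (@lettersB _ _ t) ?(eqP Uv0) //; last by ring.
congr (_ * _); rewrite (eq_bigr (fun=> letters al be X k)); last first.
  by move=> v /andP[Uv /negPf vv0]; rewrite first // vv0 (eqP Uv).
rewrite prodr_const; congr (_ ^+ _); apply: eq_card => v.
by rewrite !inE andbC.
Qed.

Lemma word_series1 :
  word_series z t s (fun _ _ => 1) = block_series z al be t :> mps 'I_K S.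
Proof.
apply: mpsP => m /=; congr (_ * _); rewrite /block_word;
  case: cid => U [dU cU] /=.
rewrite -(prod_blocks cU) (compat_sum_words t s dU).
under [in RHS]eq_bigr do rewrite -letter_sum.
rewrite (mcoef_prod_letters _ fst) big_mkcond; apply: eq_bigr => h _.
rewrite /word_ok -(eq_forallb (fun k => congr1 (eq_op _) (cU k))).
case: [forall k, _] => //=; case: forallP => [ok|nok].
  by apply: eq_bigr => v _; rewrite ok.
have [v vN] : exists v, ~~ letter_ok U v (h v).
  by apply/existsP; rewrite -negb_forall; apply/forallP.
by rewrite (bigD1 v) //= (negPf vN) mul0r.
Qed.

(** Switching off all fixed points leads to the same series from [r] as from the constant 1, and the
    latter is a product times [letters_series]. *)
Lemma word_series_main (r : nat -> 'I_N.+1 -> S) :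
  \prod_(k < K) \prod_c (1 - (s c * r k c * z) *: mpsX k) * word_series z t s r
    * (al *: \prod_(k < K) (1 - z *: mpsX k)
        - be *: \prod_(k < K) (1 - (t * z) *: mpsX k))
  = (1 - t) *: (\prod_(k < K) \prod_c (1 - (s c * z) *: mpsX k)
      * \prod_(k < K) (1 - (t * z) *: mpsX k)).
Proof.
rewrite word_series_fix -(word_series_fix z t s (fun _ _ => 1)) word_series1.
rewrite block_series_prod -!mulrA [X in _ * (_ * X)]mulrC letters_seriesE;
  last by ring.
rewrite -!scalerAr mulr1; congr (_ *: (_ * _)).
by apply: eq_bigr => k _; apply: eq_bigr => c _; rewrite mulr1.
Qed.

End WordSeriesWithoutFixedPoints.

(** * Restriction to finitely many variables *)

Section ElementarySeries.
Context {K : nat} {S : comNzRingType} (c : S).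

(** This is E(-c) in [K] variables. *)
Definition lin_prod : mps 'I_K S := \prod_(k < K) (1 - c *: mpsX k).

Lemma lin_prodE :
  lin_prod = MPS (fun m => if [forall k, (m k <= 1)%N] then (- c) ^+ mdeg m else 0).
Proof.
suff E (L : seq 'I_K) : uniq L -> \prod_(k <- L) (1 - c *: mpsX k) =
    MPS (fun m : {cmonom 'I_K} =>
      if [forall k, (m k <= (k \in L))%N] then (- c) ^+ mdeg m else 0).
  rewrite /lin_prod E ?index_enum_uniq //; apply: mpsP => m /=.
  by under eq_forallb do rewrite mem_index_enum.
elim: L => [_|k L IHL /= /andP[kL uL]].
  rewrite big_nil; apply: mpsP => m /=; rewrite mcoef1.
  case: forallP => [m0|nm].
    have -> : m = 1%M by apply/eqP/cmP => k; rewrite cm1; apply/eqP;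
      rewrite -leqn0 m0.
    by rewrite eqxx mdeg1 expr0.
  by case: eqP => // me; case: nm => k; rewrite me cm1.
rewrite big_cons IHL //; apply: mpsP => m; rewrite mcoef_1BXM /=.
have [mk|/cm_split[m' ->]] := eqVneq (m k) 0%N.
  rewrite mcoefXM0 // mulr0 subr0; congr (if _ then _ else _).
  by apply: eq_forallb => l; rewrite inE; have [->|] := eqVneq l k; rewrite ?mk.
rewrite mcoefXM /= ifN ?sub0r; last first.
  by apply/forallPn; exists k; rewrite cmM cmUU (negPf kL).
have -> : [forall l, ((U_(k) * m')%M l <= (l \in k :: L))%N] =
          [forall l, (m' l <= (l \in L))%N].
  apply: eq_forallb => l; rewrite cmM cmU inE [l == k]eq_sym.
  case: eqP => [<-|_]; last by rewrite add0n.
  by rewrite (negPf kL) add1n ltnS.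
case: ifP => _; last by rewrite mulr0 oppr0.
by rewrite mdegM mdegU add1n exprS mulNr.
Qed.

(** This is H(c) in [K] variables. *)
Definition geom_series : mps 'I_K S := MPS (fun m => c ^+ mdeg m).

(** Multiplication by 1 - c x_k leaves exactly the monomials free of x_k. *)
Lemma lin_prod_geom : lin_prod * geom_series = 1.
Proof.
suff E (L : seq 'I_K) : uniq L -> \prod_(k <- L) (1 - c *: mpsX k) * geom_series =
    MPS (fun m : {cmonom 'I_K} =>
      if [forall k in L, m k == 0%N] then c ^+ mdeg m else 0).
  rewrite /lin_prod E ?index_enum_uniq //; apply: mpsP => m /=; rewrite mcoef1.
  case: forallP => [m0|nm].
    have -> : m = 1%M.
      apply/eqP/cmP => k; rewrite cm1; apply/eqP.
      by have := m0 k; rewrite mem_index_enum.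
    by rewrite eqxx mdeg1 expr0.
  by case: eqP => // me; case: nm => k; rewrite me cm1 eqxx implybT.
elim: L => [_|k L IHL /= /andP[kL uL]].
  rewrite big_nil mul1r; apply: mpsP => m /=; rewrite ifT //.
  exact/forallP.
rewrite big_cons -mulrA IHL //; apply: mpsP => m; rewrite mcoef_1BXM /=.
have [mk|/cm_split[m' ->]] := eqVneq (m k) 0%N.
  rewrite mcoefXM0 // mulr0 subr0; congr (if _ then _ else _).
  by apply: eq_forallb => l; rewrite inE; have [->|] := eqVneq l k;
    rewrite ?mk ?eqxx ?implybT.
rewrite mcoefXM /= [RHS]ifN; last first.
  by apply/forallPn; exists k; rewrite mem_head cmM cmUU.
have -> : [forall l in L, (U_(k) * m')%M l == 0%N] = [forall l in L, m' l == 0%N].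
  apply: eq_forallb => l; rewrite cmM cmU.
  by have [<-|] := eqVneq k l; rewrite ?(negPf kL).
case: ifP => _; last by rewrite mulr0 subr0.
by rewrite mdegM mdegU add1n exprS subrr.
Qed.

End ElementarySeries.

(** * Truncation to the first K variables as a ring morphism *)

Section Embedding.
Context {K : nat}.

Definition cm_of_exp (V : choiceType) (g : 'I_K -> V) (f : 'I_K -> nat) :
  {cmonom V} :=
  \big[mmul/1%M]_(k < K) \big[mmul/1%M]_(i < f k) U_(g k)%M.

Lemma cm_of_expE (V : choiceType) (g : 'I_K -> V) f v :
  cm_of_exp g f v = (\sum_(k < K) (g k == v) * f k)%N.
Proof.
rewrite cm_prodE; apply: eq_bigr => k _; rewrite cm_prodE.
by rewrite sum_nat_const card_ord cmU mulnC.
Qed.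

Lemma cm_of_exp_inj (V : choiceType) (g : 'I_K -> V) f k : injective g ->
  cm_of_exp g f (g k) = f k.
Proof.
move=> gI; rewrite cm_of_expE (bigD1 k) //= eqxx mul1n big1 ?addn0 // => l lk.
by rewrite (inj_eq gI) (negPf lk).
Qed.

Definition widen_cm (m : {cmonom 'I_K}) : {cmonom nat} := cm_of_exp val m.
Definition restrict_cm (e : {cmonom nat}) : {cmonom 'I_K} :=
  cm_of_exp id (fun k : 'I_K => e k).

Lemma widen_cmE m (k : 'I_K) : widen_cm m k = m k.
Proof. exact: (cm_of_exp_inj _ _ val_inj). Qed.

Lemma widen_cm0 m k : (K <= k)%N -> widen_cm m k = 0%N.
Proof.
move=> Kk; rewrite cm_of_expE big1 // => l _.
by case: eqP => // lk; move: Kk; rewrite -lk /= leqNgt ltn_ord.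
Qed.

Lemma restrict_cmE e k : restrict_cm e k = e k.
Proof. by rewrite /restrict_cm (cm_of_exp_inj (g := id)). Qed.

Lemma cm_ltP (a b : {cmonom nat}) : (forall k : 'I_K, a k = b k) ->
  (forall k, (K <= k)%N -> a k = b k) -> a = b.
Proof.
move=> lo hi; apply/eqP/cmP => k; have [kK|] := ltnP k K; last exact: hi.
exact: (lo (Ordinal kK)).
Qed.

Lemma widen_cmM a b : widen_cm (a * b)%M = (widen_cm a * widen_cm b)%M.
Proof.
apply: cm_ltP => [k|k Kk]; rewrite cmM ?widen_cmE ?cmM //.
by rewrite !widen_cm0.
Qed.

Lemma widen_cm1 : widen_cm 1%M = 1%M.
Proof.
apply: cm_ltP => [k|k Kk]; first by rewrite widen_cmE !cm1.
by rewrite widen_cm0 // cm1.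
Qed.

Lemma widen_cm_inj : injective widen_cm.
Proof.
by move=> a b ab; apply/eqP/cmP => k; rewrite -!widen_cmE ab.
Qed.

Lemma restrict_cmK (e : {cmonom nat}) : (forall k, (K <= k)%N -> e k = 0%N) ->
  widen_cm (restrict_cm e) = e.
Proof.
move=> e0; apply: cm_ltP => [k|k Kk]; first by rewrite widen_cmE restrict_cmE.
by rewrite widen_cm0 ?e0.
Qed.

Lemma mdeg_widen m : mdeg (widen_cm m) = mdeg m.
Proof.
rewrite mdeg_prod mdeg_ord; apply: eq_bigr => k _.
by rewrite mdeg_prod; under eq_bigr do rewrite mdegU;
  rewrite sum1_card card_ord.
Qed.

Lemma set_bij_widen m : set_bij (mfactors m) (mfactors (widen_cm m))
  (fun p => (widen_cm p.1, widen_cm p.2)).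
Proof.
split=> [[a b] /= <-|[a b] [c d] _ _ [/= /widen_cm_inj-> /widen_cm_inj->]//|].
  by rewrite /mfactors /= widen_cmM.
move=> [a b] /= ab; have ab0 k : (K <= k)%N -> a k = 0%N /\ b k = 0%N.
  move=> Kk; have /eqP := widen_cm0 m Kk.
    by rewrite -ab cmM addn_eq0 => /andP[/eqP-> /eqP->].
have wa : widen_cm (restrict_cm a) = a by apply: restrict_cmK => k /ab0[].
have wb : widen_cm (restrict_cm b) = b by apply: restrict_cmK => k /ab0[].
exists (restrict_cm a, restrict_cm b); last by rewrite /= wa wb.
by apply: widen_cm_inj; rewrite /= widen_cmM wa wb.
Qed.

Section Truncation.
Context {V : choiceType} {R : comNzRingType}.
Implicit Types f g : mps V (mps nat R).

(** The variables x with index at least [K] are set to 0, and the two layers are exchanged: x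
    becomes the outer family, and the variables in [V] move into the coefficients. *)
Definition truncate f : mps 'I_K (mps V R) :=
  MPS (fun m => MPS (fun v => mcoef (mcoef f v) (widen_cm m))).

Lemma mcoef_truncate f m v :
  mcoef (mcoef (truncate f) m) v = mcoef (mcoef f v) (widen_cm m).
Proof. by []. Qed.

Lemma truncateB : {morph truncate : f g / f - g}.
Proof.
by move=> f g; apply: mpsP => m; rewrite mcoefB; apply: mpsP => v;
  rewrite /= !mcoefB.
Qed.

Lemma truncateM : {morph truncate : f g / f * g}.
Proof.
move=> f g; apply: mpsP => m; apply: mpsP => v /=.
rewrite !mcoefM !fsbig_finite; try exact: finite_mfactors.
rewrite !mcoef_sum; under eq_bigr => p _.
  rewrite mcoefM (reindex_fsbig _ _ _ _ (set_bij_widen m)) fsbig_finite;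
    last exact: finite_mfactors.
  over.
rewrite exchange_big; apply: eq_bigr => q _.
by rewrite mcoefM fsbig_finite //; exact: finite_mfactors.
Qed.

Lemma truncate_mpsM (u : {cmonom V}) : truncate (mpsM u) = (mpsM u)%:A.
Proof.
apply: mpsP => m; apply: mpsP => v; rewrite mcoef_truncate mcoefZ mcoef1.
rewrite mcoef_mpsM; have -> : (m == 1%M) = (widen_cm m == 1%M).
  by rewrite -widen_cm1 (inj_eq widen_cm_inj).
case: (widen_cm m =P 1%M) => [->|/eqP/negPf m1]; last first.
  by rewrite mulr0 mcoef0; case: eqP; rewrite // mcoef1 m1.
by rewrite mulr1 mcoef_mpsM; case: eqP; rewrite ?mcoef1 ?eqxx.
Qed.

Lemma mcoef_truncate_const (q : mps nat R) m :
  mcoef (truncate (q%:A)) m = (mcoef q (widen_cm m))%:A.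
Proof.
apply: mpsP => v; rewrite mcoef_truncate !mcoefZ !mcoef1.
by case: eqP; rewrite ?mulr1 ?mulr0.
Qed.

Lemma truncate1 : truncate 1 = 1.
Proof. by rewrite -mpsM1 truncate_mpsM mpsM1 scale1r. Qed.

HB.instance Definition _ := GRing.isZmodMorphism.Build _ _ truncate truncateB.
HB.instance Definition _ := GRing.isMonoidMorphism.Build _ _ truncate
  (truncate1, truncateM).

Lemma mcoef_subst_le (h : nat -> mps nat R) (a : mps V (mps nat R)) v n :
  mcoef a 1%M = 0 -> (mdeg v < n)%N ->
  mcoef (fsum [set: nat]%classic (fun i => h i *: a ^+ i)) v =
  mcoef (\sum_(i < n) h i *: a ^+ i) v.
Proof.
move=> a0 vn; rewrite mcoef_fsum (fsbigE (iota 0 n)) ?iota_uniq //; last first.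
  move=> i _; rewrite mem_iota add0n /= -leqNgt => ni.
  by rewrite mcoefZ mcoefX_lt ?mulr0 // (leq_trans vn).
rewrite mcoef_sum -(big_mkord xpredT (fun i => mcoef (h i *: a ^+ i) v)).
by rewrite /index_iota subn0; apply: eq_bigl => i; rewrite in_setT.
Qed.

(** As [h i] is homogeneous of degree [i], only the term with [i = mdeg m] reaches the coefficient
    of [m]. *)
Lemma truncate_subst (h : nat -> mps nat R) (w : {cmonom 'I_K} -> R) a c :
  mcoef a 1%M = 0 -> truncate a = c%:A ->
  (forall i m, mcoef (h i) (widen_cm m) = if mdeg m == i then w m else 0) ->
  truncate (fsum [set: nat]%classic (fun i => h i *: a ^+ i)) =
  MPS (fun m => w m *: c ^+ mdeg m).
Proof.
move=> a0 ac hw; apply: mpsP => m; apply: mpsP => v; rewrite mcoef_truncate.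
(* Beyond [mdeg v] the infinite sum can be cut to a finite one, which the morphism respects; beyond
   [mdeg m] the relevant term is kept. *)
have [n [vn mn]] : exists n, (mdeg v < n)%N /\ (mdeg m < n)%N.
  by exists (mdeg v + mdeg m).+1; lia.
rewrite (mcoef_subst_le _ a0 vn) -mcoef_truncate raddf_sum !mcoef_sum /=.
have termE i : mcoef (truncate (h i *: a ^+ i)) m =
    (if mdeg m == i then w m else 0) *: c ^+ i.
  rewrite -mulr_algl rmorphM rmorphXn /= ac exprZn expr1n -scalerAr mulr1 mcoefZ.
  by rewrite mcoef_truncate_const hw mulrC mulr_algl.
rewrite (bigD1 (Ordinal mn)) //= big1 ?addr0 => [|i im].
  by rewrite -mcoef_truncate termE eqxx.
rewrite -mcoef_truncate termE ifN ?scale0r // eq_sym;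
  apply: contra im => /eqP im.
by apply/eqP/val_inj.
Qed.

End Truncation.
End Embedding.

(** * The identity *)

Section WordMonomials.
Context {K : nat}.
Implicit Types m : {cmonom 'I_K}.

Lemma block_word_decr m : decr (block_word m).
Proof. by rewrite /block_word; case: cid => U []. Qed.

Lemma block_word_content m k :
  #|[set i | block_word m i == k]| = widen_cm m k.
Proof.
rewrite /block_word; case: cid => U [_ cU] /=; have [kK|kK] := ltnP k K.
  rewrite (widen_cmE m (Ordinal kK)) -cU.
  by apply: eq_card => i; rewrite !inE.
rewrite widen_cm0 //; apply: eq_card0 => i; rewrite inE; apply/eqP => e.
by move: kK; rewrite -e leqNgt ltn_ord.
Qed.

Lemma mcoef_words_deg n (A : set {ffun 'I_n -> nat}) m : mdeg m != n ->
  mcoef (fsum A (fun u => \prod_(i < n) xvar (u i))) (widen_cm m) = 0.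
Proof.
move=> mn; rewrite mcoef_fsum; apply: fsbig1 => u _.
under eq_bigr do rewrite /xvar mpsXE; rewrite -mpsM_prod mcoef_mpsM.
case: eqP => // e; case/eqP: mn; rewrite -mdeg_widen e mdeg_prod.
by under eq_bigr do rewrite mdegU; rewrite sum1_card card_ord.
Qed.

(** Only words with the content of [w] contribute to this monomial, and [A] contains no such word
    other than [w]. *)
Lemma mcoef_words n (A : set {ffun 'I_n -> nat}) m (w : {ffun 'I_n -> nat}) :
  (forall k, #|[set i | w i == k]| = widen_cm m k) ->
  (forall u, A u -> (forall k, #|[set i | u i == k]| = #|[set i | w i == k]|) ->
      u = w) ->
  mcoef (fsum A (fun u => \prod_(i < n) xvar (u i))) (widen_cm m) = (`[< A w >])%:R.
Proof.
move=> cw Aw; rewrite mcoef_fsum.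
have uE (u : {ffun 'I_n -> nat}) : mcoef (\prod_(i < n) xvar (u i) : xseries) (widen_cm m) =
    (widen_cm m == \big[mmul/1]_(i < n) U_(u i))%M%:R.
  by rewrite -mcoef_mpsM mpsM_prod; congr mcoef; apply: eq_bigr => i _;
    rewrite -mpsXE.
have Aw0 u : A u -> u <> w ->
  mcoef (\prod_(i < n) xvar (u i) : xseries) (widen_cm m) =
  0.
  move=> Au uw; rewrite uE; case: eqP => // e; case: uw; apply: Aw => // k.
  by rewrite cw e cm_prodU.
case: asboolP => [wA|nwA]; last by apply: fsbig1 => u Au; apply: Aw0 => // uw;
  rewrite uw in Au.
rewrite (fsbigE [:: w]) //=; last 2 first.
- by move=> u /=; rewrite inE => /eqP ->.
- by move=> u Au; rewrite inE => /eqP; exact: Aw0.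
rewrite big_cons big_nil ifT ?addr0 ?mem_set // uE.
have -> // : widen_cm m = (\big[mmul/1]_(i < n) U_(w i))%M.
  by apply/eqP/cmP => k; rewrite cm_prodU cw.
by rewrite eqxx.
Qed.

Definition incr n (U : 'I_n -> nat) :=
  forall i j : 'I_n, (i <= j)%N -> (U i <= U j)%N.

Lemma content_rev n (u : 'I_n -> nat) k :
  #|[set i | u (rev_ord i) == k]| = #|[set i | u i == k]|.
Proof.
rewrite -[RHS](card_preimset _ (@rev_ord_inj n)).
by apply: eq_card => i; rewrite !inE.
Qed.

Lemma incr_rev n (u : 'I_n -> nat) : incr u -> decr (fun i => u (rev_ord i)).
Proof. by move=> iu i j ij; apply: iu; rewrite /= leq_sub2l. Qed.

(** [hsym] and [esym] sum over increasing words, whereas [block_word] decreases. *)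
Definition rev_word m : {ffun 'I_(mdeg m) -> nat} :=
  [ffun i => block_word m (rev_ord i)].

Lemma rev_word_content m k : #|[set i | rev_word m i == k]| = widen_cm m k.
Proof.
rewrite -block_word_content -content_rev; apply: eq_card => i.
by rewrite !inE ffunE rev_ordK.
Qed.

Lemma rev_word_incr m : incr (rev_word m).
Proof.
by move=> i j ij; rewrite !ffunE; apply: block_word_decr; rewrite /= leq_sub2l.
Qed.

Lemma rev_word_uniq m (u : {ffun 'I_(mdeg m) -> nat}) : incr u ->
  (forall k, #|[set i | u i == k]| = #|[set i | rev_word m i == k]|) ->
    u = rev_word m.
Proof.
move=> iu cu; apply/ffunP => i; rewrite -[i]rev_ordK.
apply: (decr_uniq (incr_rev iu) (incr_rev (@rev_word_incr m))) => k.
by rewrite !content_rev.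
Qed.

Lemma mcoef_hsym n m : mcoef (hsym n) (widen_cm m) = if mdeg m == n then 1%R else 0.
Proof.
case: eqVneq => [<-|ne]; last exact: mcoef_words_deg.
rewrite /hsym (mcoef_words (w := rev_word m)) ?asboolT //.
- by move=> i j; exact: rev_word_incr.
- exact: rev_word_content.
by move=> u; exact: rev_word_uniq.
Qed.

Lemma mcoef_esym n m : mcoef (Defs.esym n) (widen_cm m) =
  if mdeg m == n then (if [forall k, (m k <= 1)%N] then 1%R else 0) else 0.
Proof.
case: eqVneq => [<-|ne]; last exact: mcoef_words_deg.
rewrite /Defs.esym (mcoef_words (w := rev_word m)).
- case: asboolP => inc; case: forallP => // m1.
    case: m1 => k; rewrite -widen_cmE -rev_word_content leqNgt; apply/negP.
    case/card_gt1P => [i [j [+ + ij]]]; rewrite !inE => /eqP ik /eqP jk.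
    by case: (ltngtP i j) ij => [/inc|/inc|/ord_inj->];
      rewrite ?ik ?jk ?ltnn ?eqxx.
  case: inc => i j ij; rewrite ltn_neqAle (rev_word_incr (ltnW ij)) andbT.
  apply/negP => /eqP e; have [kK|kK] := ltnP (rev_word m i) K; last first.
    have := rev_word_content m (rev_word m i);
      rewrite widen_cm0 // => /cards0_eq/setP/(_ i).
    by rewrite !inE eqxx.
  have := m1 (Ordinal kK); rewrite -widen_cmE -rev_word_content leqNgt
    => /negP; apply.
  apply/card_gt1P; exists i, j; rewrite !inE -e eqxx; split=> //.
  by apply: contraTneq ij => ->; rewrite ltnn.
- exact: rev_word_content.
move=> u inc; apply: rev_word_uniq => i j; rewrite leq_eqVlt.
by move=> /orP[/eqP/ord_inj->//|/inc/ltnW].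
Qed.

Lemma mcoef_Fqsym N n m (p : colperm N n) : mdeg m != n ->
  mcoef (Fqsym (DEX p)) (widen_cm m) = 0.
Proof. exact: mcoef_words_deg. Qed.

(** [block_word m] is the only decreasing word with this content, and [DEX_compat] decides whether
    it respects the descents. *)
Lemma mcoef_Fqsym_compat N m (p : colperm N (mdeg m)) :
  mcoef (Fqsym (DEX p)) (widen_cm m) = (compat (block_word m) p)%:R.
Proof.
rewrite /Fqsym (mcoef_words (w := [ffun i => block_word m i])).
- congr (_%:R).
  have cE : compat [ffun i => block_word m i] p = compat (block_word m) p.
    by congr compat; apply/funext => i; rewrite ffunE.
  have dw : decr [ffun i => block_word m i].
    by move=> i j; rewrite !ffunE; exact: block_word_decr.
  congr nat_of_bool; rewrite -cE; apply/asboolP/idP => [[_ H]|cp].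
    by apply/(DEX_compat p dw).
  by split=> //; apply/(DEX_compat p dw).
- by move=> k; rewrite -block_word_content; apply: eq_card => i;
    rewrite !inE ffunE.
move=> u [du _] cu; apply/ffunP => i; rewrite ffunE.
apply: (decr_uniq du (@block_word_decr m)) => k; rewrite cu.
by apply: eq_card => j; rewrite !inE ffunE.
Qed.

End WordMonomials.

Lemma prod_if_exp (R : comNzRingType) (I : finType) (P : pred I) (x : R) :
  \prod_i (if P i then x else 1%R) = x ^+ #|[set i | P i]|.
Proof.
rewrite -big_mkcond prodr_const; congr (_ ^+ _).
by apply: eq_card => i; rewrite inE.
Qed.

(** * Weights as monomials in z, t, r, s *)

Section Weights.
Context {N : nat}.
Local Notation Sg := (mps (gvar N.+1) int).
Implicit Types (al : {ffun 'I_N.+1 -> nat}) (be : {ffun 'I_N -> nat})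
  (u : {cmonom gvar N.+1}).

Definition gcm (n j : nat) al be : {cmonom gvar N.+1} :=
  (\big[mmul/1]_(i < n) U_(Zvar) * \big[mmul/1]_(i < j) U_(Tvar)
   * (\big[mmul/1]_(c < N.+1) \big[mmul/1]_(i < al c) U_(Rvar c))
   * (\big[mmul/1]_(d < N) \big[mmul/1]_(i < be d) U_(Svar (d : 'I_N.+1.-1))))%M.

Lemma gcmE n j al be v : gcm n j al be v = match v with
  Zvar => n | Tvar => j | Rvar c => al c | Svar d => be d end.
Proof.
have powE (w : gvar N.+1) k x :
  (\big[mmul/1%M]_(i < k) U_(w)%M) x = (k * (w == x))%N.
  by rewrite cm_prodE; under eq_bigr do rewrite cmU;
    rewrite sum_nat_const card_ord.
have ne (w x : gvar N.+1) : w <> x -> (w == x) = false by move/eqP/negPf.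
have eR (c d : 'I_N.+1) : (Rvar c == Rvar d) = (c == d) by apply/eqP/eqP => [[]|->].
have eS (c d : 'I_N.+1.-1) : (Svar c == Svar d) = (c == d)
  by apply/eqP/eqP => [[]|->].
rewrite !cmM !powE !cm_prodE.
under eq_bigr do rewrite powE; under [X in (_ + X)%N]eq_bigr do rewrite powE.
case: v => [||d|d]; rewrite ?eqxx ?[Zvar == _]ne
  ?[Tvar == _]ne // ?muln0 ?muln1 ?add0n.
- by rewrite !big1 ?addn0 // => c _; rewrite ne ?muln0.
- by rewrite !big1 ?addn0 // => c _; rewrite ne ?muln0.
- rewrite [X in (_ + X)%N]big1 => [|c _]; last by rewrite ne ?muln0.
  rewrite (bigD1 d) //= eqxx muln1 big1 ?addn0 // => c /negPf cd.
  by rewrite eR cd muln0.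
rewrite big1 => [|c _]; last by rewrite ne ?muln0.
rewrite (bigD1 d) //= eqxx muln1 big1 ?addn0 // => c /negPf cd.
by rewrite eS cd muln0.
Qed.

Lemma gcm_eq n j al be u : (u == gcm n j al be) =
  [&& u Zvar == n, u Tvar == j, [ffun c => u (Rvar c)] == al
    & [ffun d => u (Svar (d : 'I_N.+1.-1))] == be].
Proof.
apply/eqP/and4P => [->|[/eqP un /eqP uj /eqP ua /eqP ub]].
  by split; rewrite ?gcmE //; apply/eqP/ffunP => c; rewrite ffunE gcmE.
by apply/eqP/cmP => v; rewrite gcmE; case: v => // c; rewrite -?ua -?ub ffunE.
Qed.

Lemma mpsM_gcm (R : comNzRingType) n j al be : mpsM (gcm n j al be) =
  mpsX Zvar ^+ n * mpsX Tvar ^+ j * \prod_(c < N.+1) mpsX (Rvar c) ^+ al c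
  * \prod_(d < N) mpsX (Svar (d : 'I_N.+1.-1)) ^+ be d :> mps (gvar N.+1) R.
Proof.
rewrite !mpsMM !mpsMX -!mpsXE !mpsM_prod.
by congr (_ * _ * _ * _); apply: eq_bigr => c _; rewrite mpsMX -mpsXE.
Qed.

(** The convention s_0 = 1 treats all colors alike; color [d+1] has the variable [Svar d]. *)
Definition color_weight (c : 'I_N.+1) : Sg :=
  if unlift ord0 c is Some d then mpsX (Svar (d : 'I_N.+1.-1)) else 1.
Definition fixed_weight (k : nat) (c : 'I_N.+1) : Sg := mpsX (Rvar c).
Definition tweight : Sg := mpsX Tvar.
Definition zweight : Sg := mpsX Zvar.

Lemma weight_monomial n (U : 'I_n -> nat) (p : colperm N.+1 n) :
  zweight ^+ n * weight tweight color_weight fixed_weight U p =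
  mpsM (gcm n (exc p) (fixv p) (colv p)).
Proof.
rewrite mpsM_gcm -!mulrA; congr (_ * _).
rewrite /weight !big_split /= prod_if_exp -mulrA; congr (_ * _).
  by congr (_ ^+ _); apply: eq_card => i; rewrite inE.
rewrite mulrC; congr (_ * _).
  rewrite (partition_big p.2 predT) //=; apply: eq_bigr => c _.
  rewrite ffunE -prod_if_exp big_mkcond; apply: eq_bigr => i _.
  rewrite /word xpair_eqE !(inj_eq val_inj) /fixed_weight andbC.
  by have [->|_] := eqVneq (p.2 i) c.
rewrite (partition_big p.2 predT) //= big_ord_recl.
rewrite big1 ?mul1r => [|i /eqP ->]; last by rewrite /color_weight unlift_none.
apply: eq_bigr => d _; rewrite ffunE -prod_if_exp big_mkcond;
  apply: eq_bigr => i _.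
have -> : ord_snd (d : 'I_N.+1.-1) = lift ord0 d by apply: ord_inj.
by case: eqP => // ->; rewrite /color_weight liftK.
Qed.

End Weights.

(** * Truncations of the generating function and of H and E *)

Section Identity.
Context {N K : nat}.
Local Notation Sg := (mps (gvar N.+1) int).
Local Notation t := (@tweight N).
Local Notation z := (@zweight N).
Local Notation s := (@color_weight N).
Local Notation r := (@fixed_weight N).
Local Notation trunc := (@truncate K (gvar N.+1) int).

Lemma truncate_gf :
  trunc (fsum [set: nat * nat * {ffun 'I_N.+1 -> nat}
      * {ffun 'I_N.+1.-1 -> nat}]%classic
    (fun '(n, j, al, be) => Qsym n j al be *:
       (gz ^+ n * gt ^+ j * \prod_(c < N.+1) gr c ^+ al c
          * \prod_(d < N) gs (d : 'I_N.+1.-1) ^+ be d)))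
  = word_series z t s r.
Proof.
apply: mpsP => m; apply: mpsP => u; rewrite mcoef_truncate mcoef_fsum.
(* The only index whose monomial in z, t, r, s is [u]. *)
pose x0 := (u Zvar, u Tvar, [ffun c => u (Rvar c)],
  [ffun d => u (Svar (d : 'I_N.+1.-1))]).
rewrite (fsbigE [:: x0]) //=; last first.
  move=> [[[n j] al] be] _; rewrite inE => /eqP ne.
  rewrite -mpsM_gcm mcoefZ mcoef_mpsM gcm_eq.
  by case: and4P; rewrite ?mulr0 // => -[/eqP e1 /eqP e2 /eqP e3 /eqP e4];
    case: ne; rewrite /x0 e1 e2 e3 e4.
rewrite big_cons big_nil ifT ?addr0 ?in_setT // /x0.
rewrite -mpsM_gcm mcoefZ mcoef_mpsM gcm_eq !eqxx mulr1.
rewrite /Qsym mcoef_sum /= /compat_sum mulr_sumr mcoef_sum.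
have [e|ne] := eqVneq (u Zvar) (mdeg m); last first.
  rewrite !big1 // => p _; last by rewrite mcoef_Fqsym // eq_sym.
  by rewrite weight_monomial mcoef_mpsM gcm_eq (negPf ne).
rewrite e big_mkcond [RHS]big_mkcond; apply: eq_bigr => p _.
rewrite mcoef_Fqsym_compat weight_monomial mcoef_mpsM gcm_eq e eqxx /=.
rewrite eq_sym [fixv p == _]eq_sym [colv p == _]eq_sym.
by case: ifP; case: ifP.
Qed.

Lemma truncate_mpsX v : trunc (mpsX v) = (mpsX v)%:A.
Proof. by rewrite mpsXE truncate_mpsM -mpsXE. Qed.

Lemma truncate_Hser (a : gseries N.+1) (c : Sg) :
  mcoef a 1%M = 0 -> trunc a = c%:A -> trunc (Hser a) = geom_series c.
Proof.
move=> a0 ac; rewrite /Hser (truncate_subst (w := fun=> 1%R) a0 ac).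
  by apply: mpsP => m /=; rewrite scale1r.
by move=> i m; exact: mcoef_hsym.
Qed.

Lemma truncate_Eser (a : gseries N.+1) (c : Sg) :
  mcoef a 1%M = 0 -> trunc a = (- c)%:A -> trunc (Eser a) = lin_prod c.
Proof.
move=> a0 ac; rewrite /Eser (truncate_subst (w := fun m =>
  if [forall k, (m k <= 1)%N] then 1%R else 0) a0 ac).
  rewrite lin_prodE; apply: mpsP => m /=.
  by case: ifP => _; rewrite ?scale1r ?scale0r.
by move=> i m; exact: mcoef_esym.
Qed.

End Identity.

(** A monomial involves finitely many variables, hence survives in some truncation. *)
Lemma truncate_inj (V : choiceType) (R : comNzRingType) (f g : mps V (mps nat R)) :
  (forall K, truncate f = truncate g :> mps 'I_K _) -> f = g.
Proof.
move=> fg; apply: mpsP => v; apply: mpsP => e.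
pose K := (\max_(k <- finsupp e) k).+1.
have <- : widen_cm (restrict_cm e : {cmonom 'I_K}) = e.
  apply: restrict_cmK => k Kk; apply/eqP; rewrite cmE_eq0; apply/negP => ke.
  have : (k <= \max_(k <- finsupp e) k)%N by apply: leq_bigmax_seq.
  by rewrite leqNgt Kk.
by rewrite -!mcoef_truncate fg.
Qed.

(** [Er], [ez] and [et] stand for products of series E(-c), with inverses H(c); the last hypothesis
    is multiplied by [Hr * ht * hz]. *)
Lemma clear_denominators (R : comNzRingType) (Er Hr ez hz et ht W al be u P : R) :
  Er * Hr = 1%R -> ez * hz = 1%R -> et * ht = 1%R ->
  Er * W * (al * ez - be * et) = u * (ez * P * et) ->
  W * (al * ht - be * hz) = u * (Hr * P).
Proof.
move=> EH zz tt main.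
transitivity (Hr * ht * hz * (Er * W * (al * ez - be * et))).
  transitivity ((Er * Hr) * W * (al * ht * (ez * hz) - be * hz * (et * ht))).
    by rewrite EH zz tt !mulr1 mul1r.
  by ring.
rewrite main; transitivity (u * (Hr * P) * (ez * hz) * (et * ht)).
  by ring.
by rewrite zz tt !mulr1.
Qed.

Theorem theorem1p1 (N : nat) (hN : (0 < N)%N) :
  fsum [set: nat * nat * {ffun 'I_N -> nat} * {ffun 'I_N.-1 -> nat}]%classic
    (fun '(n, j, al, be) => Qsym n j al be *:
       (gz ^+ n * gt ^+ j * \prod_(c < N) gr c ^+ al c
          * \prod_(m < N.-1) gs m ^+ be m))
  = (Hser (gr (Ordinal hN) * gz) * (1 - gt)
       * \prod_(m < N.-1) (Eser (- gs m * gz) * Hser (gr (ord_snd m) * gs m * gz)))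
    / ((1 + \sum_(m < N.-1) gs m) * Hser (gt * gz)
         - (gt + \sum_(m < N.-1) gs m) * Hser gz).
Proof.
case: N hN => // N hN; have Du := denominator_unit N.+1.
(* The denominator is invertible, so the numerators are compared after cross-multiplication, in [K]
   variables for every [K]. *)
rewrite -[LHS](mulrK Du); congr (_ / _); apply: truncate_inj => K.
rewrite truncateM truncate_gf.
have z0 (a : gseries N.+1) : mcoef (a * gz) 1%M = 0.
  by rewrite mcoefM1 mcoef_mpsX1 mulr0.
have truncB v : truncate (mpsX v : gseries N.+1) = (mpsX v)%:A :> mps 'I_K _
  := truncate_mpsX v.
have AM (a b : mps (gvar N.+1) int) :
  a%:A * b%:A = (a * b)%:A :> mps 'I_K (mps (gvar N.+1) int).
  by rewrite -scalerAl mul1r scalerA.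
have hz : truncate (Hser gz) = geom_series (zweight (N := N)) :> mps 'I_K _.
  by apply: truncate_Hser; rewrite ?mcoef_mpsX1 ?truncB.
have ht : truncate (Hser (gt * gz)) =
  geom_series (tweight * zweight (N := N)) :> mps 'I_K _.
  by apply: truncate_Hser; rewrite ?z0 // rmorphM /= !truncB AM.
pose s := @color_weight N; pose r := @fixed_weight N 0; pose z := @zweight N;
  pose t := @tweight N.
pose sg := \sum_(c < N) s (lift ord0 c).
have sE (d : 'I_N) : s (lift ord0 d) = mpsX (Svar (d : 'I_N.+1.-1)).
  by rewrite /s /color_weight liftK.
have sgE : truncate (\sum_(d < N) gs (d : 'I_N.+1.-1)) = sg%:A :> mps 'I_K _.
  rewrite raddf_sum /sg scaler_suml; apply: eq_bigr => d _.
  by rewrite sE; exact: truncB.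
have -> : truncate ((1 + \sum_(d < N) gs (d : 'I_N.+1.-1)) * Hser (gt * gz)
    - (gt + \sum_(d < N) gs (d : 'I_N.+1.-1)) * Hser gz) =
    (1 + sg)%:A * geom_series (t * z) - (t + sg)%:A * geom_series z :> mps 'I_K _.
  rewrite truncateB !truncateM !rmorphD /= sgE ht hz truncB truncate1.
  by rewrite !scalerDl scale1r.
have s0 : s ord0 = 1%R by rewrite /s /color_weight unlift_none.
(* With s_0 = 1, the factor H(r_0 z) joins the factors H(r_m s_m z) in one product over all
   colors. *)
pose w c : mps (gvar N.+1) int := s c * r c * z.
have -> : truncate (Hser (gr (Ordinal hN) * gz) * (1 - gt)
    * \prod_(d < N) (Eser (- gs (d : 'I_N.+1.-1) * gz)
        * Hser (gr (ord_snd (d : 'I_N.+1.-1)) * gs (d : 'I_N.+1.-1) * gz))) =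
    (1 - t)%:A * (\prod_c geom_series (w c)
        * \prod_(d < N) lin_prod (s (lift ord0 d) * z)) :> mps 'I_K _.
  rewrite !truncateM truncateB truncate1 truncB rmorph_prod /= big_ord_recl.
  rewrite (@truncate_Hser _ _ _ (w ord0)) ?z0 //; last first.
    rewrite truncateM !truncB AM /w s0 mul1r; congr ((_ * _)%:A).
    by rewrite (_ : Ordinal hN = ord0) //; apply: val_inj.
  rewrite scalerBl scale1r -mulrA mulrCA -[in RHS]mulrA; congr (_ * (_ * _)).
  rewrite -big_split /=; apply: eq_bigr => d _; rewrite truncateM mulrC;
    congr (_ * _).
    apply: truncate_Hser; rewrite ?z0 // !truncateM !truncB !AM /w -sE.
    rewrite [_ * s _]mulrC; congr ((_ * _ * _)%:A).
    by rewrite /r /fixed_weight; congr (mpsX (Rvar _)); apply: ord_inj.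
  apply: truncate_Eser; rewrite ?z0 // truncateM !truncB
    (rmorphN truncate) /= truncB.
  by rewrite -sE mulNr AM scaleNr.
have main := word_series_main (K := K) z t s0 (@fixed_weight N).
have colorE (f : 'I_N.+1 -> mps (gvar N.+1) int) :
    \prod_(k < K) \prod_c (1 - f c *: mpsX k)
      = \prod_c lin_prod (f c) :> mps 'I_K _.
  exact: exchange_big.
rewrite (colorE w) (colorE (fun c => s c * z)) in main.
apply: (@clear_denominators _ (\prod_c lin_prod (w c)) _ (lin_prod z)
  _ (lin_prod (t * z))).
- by rewrite -big_split big1 // => c _; exact: lin_prod_geom.
- exact: lin_prod_geom.
- exact: lin_prod_geom.
rewrite !mulr_algl; apply: etrans main _; congr (_ *: (_ * _)).
(* Color 0 supplies the factor [lin_prod z]; the other colors give the product of the E(-s_m z). *)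
rewrite big_ord_recl s0 mul1r; congr (_ * _).
Qed.
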